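(* Let $p\ge5$ be a prime, let $r=(p-1)/2$, and let $K$ be a $D_p$-extension with a unique real embedding. Let $\mathbf{Q}^+=\mathbf{Q}(\zeta_p+\zeta_p^{-1})$, let $\varphi\colon\mathbf{Q}^+\otimes\mathbf{R}\to H$ be the linear isomorphism defined in the context, and let $\mathfrak{a}=\varphi^{-1}(\mathrm{Log}(E_K))$. Then the regulator $R_K$ of $K$ is given by $$R_K=N(\mathfrak{a})\,\mathrm{disc}(\mathbf{Q}^+).$$
   Context: A $D_p$-extension is a number field $K$ of degree $p$ over $\mathbf{Q}$ whose Galois closure over $\mathbf{Q}$ has Galois group isomorphic to the dihedral group $D_p$ of order $2p$. Let $K$ have unique real embedding $\iota$ and pairs of complex conjugate embeddings $\tau_1,\overline{\tau_1},\dots,\tau_r,\overline{\tau_r}$. Let $E_K=\mathcal{O}_K^\times/\text{torsion}$ and $\mathrm{Log}\colon E_K\to\mathbf{R}^{r+1}$, $u\mapsto(\log|\iota(u)|,2\log|\tau_1(u)|,\dots,2\log|\tau_r(u)|)$. Its image is a lattice of full rank $r$ in the hyperplane $H\subset\mathbf{R}^{r+1}$ of vectors whose coordinates sum to $0$. The regulator $R_K$ is the usual one: the absolute value of any $r\times r$ minor of the $r\times(r+1)$ matrix whose rows are the images under $\mathrm{Log}$ of a $\mathbf{Z}$-basis of $E_K$. Let $\zeta_p$ be a primitive $p$-th root of unity, and let $A^+=\mathbf{Z}[\zeta_p+\zeta_p^{-1}]$ be the ring of integers of $\mathbf{Q}^+$, with $\mathbf{Z}$-basis $B=[1,\zeta_p+\zeta_p^{-1},\dots,\zeta_p^{r-1}+\zeta_p^{1-r}]$.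 Let $G$ be the Gram matrix of the trace form $(x,y)\mapsto\mathrm{Tr}_{\mathbf{Q}^+/\mathbf{Q}}(xy)$ in the basis $B$. Let $\widetilde{G}$ be the $r\times(r+1)$ matrix obtained by appending to $G$ a last column whose $j$-th entry is $-\sum_{i}G_{ji}$ (sum over the $r$ columns of $G$). Index the rows of $\widetilde{G}$ from $0$ to $r-1$. The map $\varphi\colon\mathbf{Q}^+\otimes\mathbf{R}\to H$ is the $\mathbf{R}$-linear map sending $1$ to the $0$-th row of $\widetilde{G}$ and $\zeta_p^i+\zeta_p^{-i}$ to the $i$-th row for $1\le i<r$; it is an isomorphism of vector spaces. Thus $\mathfrak{a}$ is a free abelian group of rank $r$ spanning $\mathbf{Q}^+\otimes\mathbf{R}$. $N(\mathfrak{a})$ denotes the absolute value of the determinant of a matrix sending a $\mathbf{Z}$-basis of $A^+$ to a $\mathbf{Z}$-basis of $\mathfrak{a}$. $\mathrm{disc}(\mathbf{Q}^+)$ is the discriminant of the number field $\mathbf{Q}^+$. *)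

(* Defs.v *)
From HB Require Import structures.
From mathcomp Require Import all_boot all_order all_algebra all_fingroup all_field.
From mathcomp Require extremal.
From mathcomp Require Import complex.
From mathcomp Require Import boolp classical_sets reals exp.

Set Implicit Arguments.
Unset Strict Implicit.
Unset Printing Implicit Defensive.

Import Order.TTheory GRing.Theory Num.Theory.

Local Open Scope ring_scope.

(* [f] exhibits [M] as the smallest Galois extension of Q containing [K]. *)
Definition galois_closure (K : fieldExtType rat) (M : splittingFieldType rat)
    (f : 'AHom(K, M)) : Prop :=
  galois 1 {:M} /\
  forall E : {subfield M}, (limg f <= E)%VS -> galois 1 E -> E = {:M}%VS :> {vspace M}.

(* [dihedral_gtype m] is indexed by the order [m] of the group. *)
Definition dihedral_extension (p : nat) (K : fieldExtType rat) : Prop :=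
  \dim {:K} = p /\
  exists (M : splittingFieldType rat) (f : 'AHom(K, M)),
    galois_closure f /\
    ('Gal({:M} / 1) \isog [set: extremal.dihedral_gtype p.*2])%g.

Section Lattices.

Variables (V : zmodType) (n : nat).

Definition Z_basis (S : set V) (b : 'I_n -> V) : Prop :=
  (forall x, S x <-> exists c : 'I_n -> int, x = \sum_i b i *~ c i) /\
  (forall c : 'I_n -> int, \sum_i b i *~ c i = 0 -> forall i, c i = 0).

End Lattices.

Section NumberField.

Variable F : fieldExtType rat.

Definition algebraic_integer (x : F) : Prop := integralOver (intr : int -> F) x.

Definition field_trace (x : F) : rat :=
  \tr (passmx.mxof (vbasis {:F}) (vbasis {:F}) (amull x)).

Definition trace_gram n (b : 'I_n -> F) : 'M[rat]_n :=
  \matrix_(i, j) field_trace (b i * b j).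

(* The determinant does not depend on the integral basis; [xget] picks its
   common value (and would return 0 if there were no integral basis). *)
Definition discriminant : rat :=
  xget 0 [set d : rat | exists b : 'I_(\dim {:F}) -> F,
    Z_basis [set x | algebraic_integer x] b /\ d = \det (trace_gram b)]%classic.

Definition integral_unit (x : F) : Prop :=
  [/\ x != 0, algebraic_integer x & algebraic_integer x^-1].

Definition root_of_unity (w : F) : Prop := exists2 n, (0 < n)%N & w ^+ n = 1.

(* The classes of the [u i] form a Z-basis of the integral units modulo
   torsion, the latter written multiplicatively. *)
Definition unit_basis n (u : 'I_n -> F) : Prop :=
  [/\ forall i, integral_unit (u i),
      forall x, integral_unit x -> exists (c : 'I_n -> int) (w : F),
        root_of_unity w /\ x = w * \prod_i u i ^ c i
    & forall c : 'I_n -> int,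
        root_of_unity (\prod_i u i ^ c i) -> forall i, c i = 0].

End NumberField.

Section Regulator.

Variables (R : realType) (K : fieldExtType rat) (r : nat).
Variables (iota : {rmorphism K -> R}) (tau : 'I_r -> {rmorphism K -> R[i]}).

(* [tau] lists one member of each pair of complex conjugate embeddings of [K],
   and [iota] is the only remaining embedding. *)
Definition one_real_embedding : Prop :=
  [/\ forall iota' : {rmorphism K -> R}, iota' =1 iota,
      forall i, ~ (tau i =1 (fun x => conjc (tau i x))),
      forall i j, tau i =1 tau j \/ tau i =1 (fun x => conjc (tau j x)) -> i = j
    & forall sigma : {rmorphism K -> R[i]},
        sigma =1 (fun x => real_complex R (iota x)) \/
        exists i, sigma =1 tau i \/ sigma =1 (fun x => conjc (tau i x))].

Definition Log (u : K) : 'rV[R]_r.+1 :=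
  \row_(j < r.+1)
    if unlift ord0 j is Some k then 2 * ln (ComplexField.Normc.normc (tau k u))
    else ln `|iota u|.

(* All units with a given class modulo torsion have the same [Log], and the
   value below depends neither on [u] nor on the deleted column [k]; [xget]
   picks it (and would return 0 if there were no [unit_basis] of size [r]). *)
Definition regulator : R :=
  xget 0 [set x : R | exists (u : 'I_r -> K) (k : 'I_r.+1),
    unit_basis u /\ x = `|\det (col' k (\matrix_(i < r) Log (u i)))|]%classic.

Definition log_units : set 'rV[R]_r.+1 :=
  [set v | exists2 u, integral_unit u & v = Log u]%classic.

End Regulator.

(* The universal property of V = F ⊗_Q R, with [j] the map x |-> x ⊗ 1. *)
Section ScalarExtension.

Variables (R : realType) (F : fieldExtType rat).

Definition Q_linear (W : lmodType R) (f : F -> W) : Prop :=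
  forall (a : rat) (x y : F), f (a *: x + y) = ratr a *: f x + f y.

Definition scalar_extension (V : lmodType R) (j : F -> V) : Prop :=
  Q_linear j /\
  forall (W : lmodType R) (f : F -> W), Q_linear f ->
    exists g : {linear V -> W}, g \o j =1 f /\
      forall g' : {linear V -> W}, g' \o j =1 f -> g' =1 g.

(* The generalised index of the lattice [B] relative to the lattice [A], both
   of rank [n], where [A] is viewed in [V] through [j]. As for [regulator],
   the value does not depend on the choice of the bases. *)
Definition lattice_norm n (V : lmodType R) (j : F -> V) (A : set F) (B : set V) : R :=
  xget 0 [set x : R | exists (a : 'I_n -> F) (b : 'I_n -> V) (M : 'M[R]_n),
    [/\ Z_basis A a, Z_basis B b,
        forall i, b i = \sum_k M i k *: j (a k)
      & x = `|\det M|]]%classic.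

End ScalarExtension.

Section RealCyclotomic.

Variables (L : fieldExtType rat) (z : L).

Definition Qplus : fieldExtType rat := subvs_of <<1; z + z^-1>>%AS.

(* The argument of [vsproj] lies in Q(z + z^-1), so it is not changed. *)
Definition Qplus_gen : Qplus := vsproj _ (z + z^-1).

Definition Aplus : set Qplus :=
  [set x | exists q : {poly int}, x = (map_poly intr q).[Qplus_gen]]%classic.

Definition Qplus_basis (i : nat) : Qplus :=
  if i == 0%N then 1 else vsproj _ (z ^+ i + z ^- i).

Definition Qplus_gram (r : nat) : 'M[rat]_r :=
  trace_gram (fun i : 'I_r => Qplus_basis i).

Definition extended_gram (r : nat) : 'M[rat]_(r, r.+1) :=
  \matrix_(i < r, k < r.+1)
    if unlift ord_max k is Some l then Qplus_gram r i l
    else - \sum_l Qplus_gram r i l.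

End RealCyclotomic.

(* Main.v *)
Require Import Defs.
From HB Require Import structures.
From mathcomp Require Import all_boot all_order all_algebra all_fingroup all_field.
From mathcomp Require Import complex.
From mathcomp Require Import boolp classical_sets reals exp.
From mathcomp Require Import ring lra zify.

(** The formula is a change of coordinates. Write [Gt] for the extended Gram
    matrix and [G] for the Gram matrix itself. A Z-basis of the preimage of the
    unit lattice, expressed through a Z-basis of A+ by a real matrix [M], is
    carried by [phi] to the rows of [M *m Gt], up to a unimodular factor; these
    rows form a Z-basis of the unit lattice. A maximal minor of [M *m Gt] is
    det M * det G up to sign, because all maximal minors of a matrix whose rows
    sum to zero agree up to sign ([norm_minor_zero_sum]). So everything rests on
    det G being the discriminant, that it is positive, and on the dictionary
    between bases of units modulo torsion and Z-bases of Log(units).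

    If the units have no basis of size [r], the preimage lattice has none
    either, and both sides are 0 by convention; otherwise a basis on one side
    yields a basis on the other, and any choice gives the same value. This
    dictionary uses two facts about the full list of p complex embeddings of K:
    the product formula (Log lands in the hyperplane of zero-sum vectors,
    [integral_unit_sum_Log]) and Kronecker's theorem (the kernel of Log is
    torsion, [integral_normc1_root_of_unity]). Both reduce to the integrality of
    the norm, which is computed by diagonalizing multiplication in the basis
    given by the embeddings.

    On the side of Q+, composing an embedding of L into the algebraic numbers
    with the Galois automorphisms of cyclotomic fields gives r distinct real
    embeddings, whence \dim Q+ = r, the traces of the z^k + z^-k, and
    G = P * P^T with P real and invertible, so that det G > 0. That G computes the
    discriminant means that A+ is the full ring of integers
    ([Qplus_integralP]): trace integrality gives p x in A+ for integral x
    ([two_cos_expansion]), and the factor p is then removed using that p is an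
    associate of the r-th power of 2 - (z + z^-1)
    ([real_cyclotomic_order_saturated]). *)

Set Implicit Arguments.
Unset Strict Implicit.
Unset Printing Implicit Defensive.

Import Order.TTheory GRing.Theory Num.Theory.

Local Open Scope ring_scope.

(** * Integrality over Z and embeddings of number fields *)

Lemma integralOver_int_rmorph (A B : nzRingType) (f : {rmorphism A -> B}) x :
  integralOver (intr : int -> A) x -> integralOver (intr : int -> B) (f x).
Proof.
case=> q q_monic qx0; exists q => //.
have -> : map_poly intr q = map_poly f (map_poly intr q).
  by rewrite -map_poly_comp; apply: eq_map_poly => a /=; rewrite rmorph_int.
exact: rmorph_root.
Qed.

Lemma integralOver_int_fmorph (A : fieldType) (B : nzRingType)
    (f : {rmorphism A -> B}) x :
  integralOver (intr : int -> B) (f x) -> integralOver (intr : int -> A) x.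
Proof.
case=> q q_monic qx0; exists q => //; rewrite -(fmorph_root f) -map_poly_comp.
by rewrite (eq_map_poly (_ : _ =1 intr)) // => a /=; rewrite rmorph_int.
Qed.

Lemma algebraic_integerX (F : fieldExtType rat) (x : F) n :
  algebraic_integer x -> algebraic_integer (x ^+ n).
Proof.
move=> x_int; elim: n => [|n IHn]; first exact: integral1.
by rewrite exprS; apply: integral_mul.
Qed.

Lemma integralOver_int_rat (C : numFieldType) (t : rat) :
  integralOver (intr : int -> C) (ratr t) -> exists m : int, t = m%:~R.
Proof.
move=> /integralOver_int_fmorph[q q_monic qt].
have : (ratr t : algC) \in Num.int.
  apply: Cint_rat_Aint; first by rewrite Crat_rat.
  apply: (@root_monic_Aint (map_poly intr q)); last 2 first.
  - exact: monic_map.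
  - by apply/polyOverP => i; rewrite coef_map /= rpred_int.
  rewrite (eq_map_poly (_ : _ =1 (ratr : rat -> algC) \o intr)); last first.
    by move=> a /=; rewrite rmorph_int.
  by rewrite map_poly_comp fmorph_root.
case/intrP=> m tm; exists m; apply: (fmorph_inj (ratr : rat -> algC)).
by rewrite rmorph_int; exact: tm.
Qed.

Lemma number_field_primitive_element (F : fieldExtType rat) :
  exists a : F, forall x, exists q : {poly rat}, x = (map_poly (in_alg F) q).[a].
Proof.
have sepF : separable 1 {:F}.
  apply/separableP => y _; apply: pcharf0_separable => q.
  by rewrite pchar_lalg pchar_num.
exists (separable_generator 1 {:F}) => x; apply/Fadjoin1_polyP.
by rewrite -(eq_adjoin_separable_generator sepF (sub1v _)) memvf.
Qed.

(** With a primitive element [a] and a root [w] of its minimal polynomial, the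
    embedding is q(a) |-> q(w); it is well defined since two polynomials with the
    same value at [a] differ by a multiple of the minimal polynomial. *)
Lemma number_field_embedding (F : fieldExtType rat) :
  inhabited {rmorphism F -> algC}.
Proof.
have [a gen_a] := number_field_primitive_element F.
pose ev q := (map_poly (in_alg F) q).[a].
pose poly_of x := sval (sig_eqW (gen_a x)).
have poly_ofK x : x = ev (poly_of x) by rewrite /poly_of; case: sig_eqW.
have [m m_min] : exists m, minPoly 1 a = map_poly (in_alg F) m.
  exact/polyOver1P/minPolyOver.
have [w mw0] : exists w, root (map_poly (ratr : rat -> algC) m) w.
  apply/closed_rootP; rewrite size_map_poly -(size_map_poly (in_alg F)) -m_min.
  by rewrite size_minPoly eqSS -lt0n.
pose evw q := (map_poly (ratr : rat -> algC) q).[w].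
have ev_evw q q' : ev q = ev q' -> evw q = evw q'.
  move=> eq_ev; apply/eqP; rewrite -subr_eq0 /evw -hornerN -hornerD -!rmorphB /=.
  have : m %| q - q'.
    rewrite -(dvdp_map (in_alg F)) -m_min; apply: minPoly_dvdp.
      exact: alg_polyOver.
    by rewrite /root rmorphB hornerD hornerN -/(ev q) -/(ev q') eq_ev subrr.
  case/dvdpP=> u ->; rewrite rmorphM hornerM.
  by move/eqP: mw0 => ->; rewrite mulr0.
pose phi x := evw (poly_of x).
have phi_zmod : zmod_morphism phi.
  move=> x y; rewrite /phi /evw -hornerN -hornerD -rmorphB; apply: ev_evw.
  by rewrite -poly_ofK /ev rmorphB hornerD hornerN -!/(ev _) -!poly_ofK.
have phi_monoid : monoid_morphism phi.
  split=> [|x y].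
    rewrite -[RHS](hornerC (1 : algC) w) -[1%:P](rmorph1 (map_poly ratr)).
    by apply: ev_evw; rewrite -poly_ofK /ev rmorph1 hornerC.
  rewrite /phi /evw -hornerM -rmorphM; apply: ev_evw.
  by rewrite -poly_ofK /ev rmorphM hornerM -!/(ev _) -!poly_ofK.
pose phi_M := GRing.isZmodMorphism.Build F algC phi phi_zmod.
pose phi_MM := GRing.isMonoidMorphism.Build F algC phi phi_monoid.
pose phi_RM : {rmorphism F -> algC} := HB.pack phi phi_M phi_MM.
by constructor; exact: phi_RM.
Qed.

Section Embeddings.

Variables (F : fieldExtType rat) (C : numFieldType).

Definition emb_mx m n (s : 'I_n -> {rmorphism F -> C}) (b : 'I_m -> F) :
    'M[C]_(m, n) := \matrix_(k, i) s i (b k).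

Definition Q_spanning m (b : 'I_m -> F) :=
  forall x, exists c : 'I_m -> rat, x = \sum_k c k *: b k.

Definition Q_free m (b : 'I_m -> F) :=
  forall c : 'I_m -> rat, \sum_k c k *: b k = 0 -> forall k, c k = 0.

Lemma emb_lincomb (s : {rmorphism F -> C}) m (c : 'I_m -> rat) (b : 'I_m -> F) :
  s (\sum_k c k *: b k) = \sum_k ratr (c k) * s (b k).
Proof. by rewrite rmorph_sum; apply: eq_bigr => k _; rewrite rmorphZ_num. Qed.

Section Distinct.

Variables (n : nat) (s : 'I_n -> {rmorphism F -> C}).
Hypothesis s_inj : forall i j, s i =1 s j -> i = j.

(** Distinct embeddings already differ at a primitive element, so on its powers
    the matrix is an invertible Vandermonde matrix. *)
Lemma emb_mx_powers_unit : exists a : F, emb_mx s (fun k : 'I_n => a ^+ k) \in unitmx.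
Proof.
have [a gen_a] := number_field_primitive_element F; exists a.
have s_a_inj i j : s i a = s j a -> i = j.
  move=> sa; apply: s_inj => x; have [q ->] := gen_a x.
  rewrite -!horner_map -sa -!map_poly_comp; congr _.[_].
  by apply: eq_map_poly => c /=; rewrite alg_num_field !fmorph_rat.
have -> : emb_mx s (fun k : 'I_n => a ^+ k) = Vandermonde n (\row_i s i a).
  by apply/matrixP => k i; rewrite !mxE rmorphXn.
rewrite unitmxE det_Vandermonde unitfE; apply/prodf_neq0 => i _.
apply/prodf_neq0 => j ij; rewrite !mxE subr_eq0; apply/eqP => /s_a_inj ji.
by rewrite ji ltnn in ij.
Qed.

Lemma emb_mx_spanning m (b : 'I_m -> F) : Q_spanning b ->
  exists A : 'M[C]_(n, m), A *m emb_mx s b \in unitmx.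
Proof.
move=> /choice[c cE]; have [a Ua] := emb_mx_powers_unit.
exists (\matrix_(k, l) ratr (c (a ^+ k) l)); congr (_ \in unitmx): Ua.
apply/matrixP => k i; rewrite !mxE {1}[a ^+ k]cE emb_lincomb.
by apply: eq_bigr => l _; rewrite !mxE.
Qed.

(** Lower bound on the degree: with [m] spanning vectors the invertible matrix on
    powers of a primitive element has rank at most [m]. *)
Lemma emb_le_spanning m (b : 'I_m -> F) : Q_spanning b -> (n <= m)%N.
Proof.
move=> /emb_mx_spanning[A]; rewrite -row_free_unit /row_free => /eqP {1}<-.
by apply: leq_trans (mxrankM_maxl _ _) (rank_leq_col _).
Qed.

Lemma emb_mx_spanning_unit (b : 'I_n -> F) : Q_spanning b ->
  emb_mx s b \in unitmx.
Proof. by move=> /emb_mx_spanning[A]; rewrite unitmx_mul => /andP[]. Qed.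

Lemma emb_mx_unit_free (b : 'I_n -> F) : emb_mx s b \in unitmx -> Q_free b.
Proof.
move=> b_unit c c0 k.
have : \row_l ratr (c l) *m emb_mx s b = 0.
  apply/rowP => i; rewrite !mxE -[RHS](rmorph0 (s i)) -c0 emb_lincomb.
  by apply: eq_bigr => l _; rewrite !mxE.
move/(congr1 (mulmx^~ (invmx (emb_mx s b)))); rewrite mulmxK // mul0mx.
by move=> /rowP/(_ k); rewrite !mxE => /eqP; rewrite fmorph_eq0 => /eqP.
Qed.

End Distinct.

Lemma vbasis_spanning : Q_spanning (fun k : 'I_(\dim {:F}) => (vbasis {:F})`_k).
Proof.
by move=> x; exists (fun k => coord (vbasis {:F}) k x); apply/coord_vbasis/memvf.
Qed.

Definition mul_mx (x : F) := passmx.mxof (vbasis {:F}) (vbasis {:F}) (amull x).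

(** The columns of [P] are the embeddings evaluated at the basis, which are
    common eigenvectors of all multiplications; norm and trace follow. *)
Lemma mul_mx_emb_diag (s : 'I_(\dim {:F}) -> {rmorphism F -> C})
    (s_inj : forall i j, s i =1 s j -> i = j) x :
  exists2 P, P \in unitmx &
    map_mx ratr (mul_mx x) *m P = P *m diag_mx (\row_i s i x).
Proof.
exists (emb_mx s (fun k : 'I_(\dim {:F}) => (vbasis {:F})`_k)).
  exact/emb_mx_spanning_unit/vbasis_spanning.
apply/matrixP => k i; rewrite mul_mx_diag !mxE mulrC -rmorphM.
have -> : x * (vbasis {:F})`_k = \sum_l mul_mx x k l *: (vbasis {:F})`_l.
  rewrite [LHS](coord_vbasis (memvf _)); apply: eq_bigr => l _.
  by rewrite !mxE /= passmx.vecof_delta lfunE.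
by rewrite emb_lincomb; apply: eq_bigr => l _; rewrite !mxE.
Qed.

Section AllEmbeddings.

Variables (T : finType) (s : T -> {rmorphism F -> C}).
Hypotheses (s_inj : forall i j, s i =1 s j -> i = j) (cardT : #|T| = \dim {:F}).

(* Index the embeddings by the rows of [mul_mx]. *)
Let s' (i : 'I_(\dim {:F})) := s (enum_val (cast_ord (esym cardT) i)).

Let s'_inj i j : s' i =1 s' j -> i = j.
Proof. by move/s_inj/enum_val_inj/cast_ord_inj. Qed.

Let big_s' (idx : C) (op : Monoid.com_law idx) x :
  \big[op/idx]_i s' i x = \big[op/idx]_t s t x.
Proof.
rewrite [RHS](reindex (fun i => enum_val (cast_ord (esym cardT) i))) //=.
exists (fun t => cast_ord cardT (enum_rank t)) => i _.
  by rewrite enum_valK cast_ordKV.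
by rewrite cast_ordK enum_rankK.
Qed.

Lemma ratr_det_mul_mx x : ratr (\det (mul_mx x)) = \prod_t s t x.
Proof.
have [P Pu /(congr1 determinant)] := mul_mx_emb_diag s'_inj x.
rewrite !det_mulmx det_diag mulrC det_map_mx => /mulrI -> //.
by rewrite -big_s'; apply: eq_bigr => i _; rewrite mxE.
Qed.

Lemma ratr_field_trace x : ratr (field_trace x) = \sum_t s t x.
Proof.
have [P Pu xP] := mul_mx_emb_diag s'_inj x.
transitivity (\tr (map_mx (ratr : rat -> C) (mul_mx x))).
  by rewrite trace_map_mx.
rewrite -[map_mx _ _](mulmxK Pu) xP mxtrace_mulC mulmxA mulVmx // mul1mx.
by rewrite mxtrace_diag -big_s'; apply: eq_bigr => i _; rewrite mxE.
Qed.

(** The norm of an algebraic integer is rational and integral over Z. *)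
Lemma integral_prod_emb x : algebraic_integer x ->
  exists m : int, \prod_t s t x = m%:~R.
Proof.
move=> x_int; rewrite -ratr_det_mul_mx.
have [|m ->] := @integralOver_int_rat C (\det (mul_mx x)); last first.
  by exists m; rewrite rmorph_int.
rewrite ratr_det_mul_mx; elim/big_rec: _ => [|t y _ y_int].
  exact: integral1.
exact/integral_mul/y_int/integralOver_int_rmorph.
Qed.

Lemma integral_field_trace (x : F) : algebraic_integer x ->
  exists m : int, field_trace x = m%:~R.
Proof.
move=> x_int; apply: (@integralOver_int_rat C).
rewrite ratr_field_trace; elim/big_rec: _ => [|t y _ y_int].
  exact: integral0.
exact/integral_add/y_int/integralOver_int_rmorph.
Qed.

End AllEmbeddings.

End Embeddings.

(** * Roots of unity and the numbers x^n + x^-n *)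

(** The Dickson polynomials: D_0 = 2, D_1 = X, D_(n+2) = X D_(n+1) - D_n. One
    polynomial serves all fields, which allows substituting a power of [x] for
    [x] and evaluating at x = 1. *)
Lemma dickson_poly n : exists D : {poly int}, forall (E : fieldType) (x : E),
  x != 0 -> (map_poly intr D).[x + x^-1] = x ^+ n + x ^- n.
Proof.
elim/ltn_ind: n => -[|[|n]] IHn.
- exists 2%:P => E x _; rewrite map_polyC /= hornerC expr0 invr1.
  by rewrite -natr1.
- by exists 'X => E x _; rewrite map_polyX hornerX expr1.
have [D DE] := IHn n.+1 (ltnSn _); have [D' D'E] := IHn n (ltnW (ltnSn _)).
exists ('X * D - D') => E x x0.
rewrite rmorphB rmorphM /= map_polyX hornerD hornerN hornerM hornerX DE // D'E //.
by rewrite !exprS; field; rewrite expf_neq0.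
Qed.

(** D_n(2) = 2, as the case x = 1 shows, so X - 2 divides D_n - 2. *)
Lemma two_sub_dickson_poly n : exists Q : {poly int}, forall (E : fieldType) (x : E),
  x != 0 -> 2 - (x ^+ n + x ^- n) = (2 - (x + x^-1)) * (map_poly intr Q).[x + x^-1].
Proof.
have [D DE] := dickson_poly n.
have /factor_theorem[Q DQ] : root (2%:P - D) 2.
  have := DE rat 1 (oner_neq0 _); rewrite expr1n invr1.
  rewrite -[1 + 1 in LHS]/(2%:~R) horner_map /= -[1 + 1 in RHS]/(2%:~R).
  by move/(@intr_inj rat) => D2; rewrite /root hornerD hornerN hornerC D2 subrr.
exists (- Q) => E x x0; rewrite -DE //.
have := congr1 (fun q => (map_poly intr q).[x + x^-1]) DQ.
rewrite rmorphB rmorphM /= rmorphB /= map_polyX !map_polyC rmorphN /=.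
by rewrite !hornerE => ->; rewrite -[2%:~R]/(2%:R : E); ring.
Qed.

Lemma prim_root_neq0 (E : fieldType) (n : nat) (x : E) :
  n.-primitive_root x -> x != 0.
Proof.
move=> x_prim; have := prim_expr_order x_prim; have := prim_order_gt0 x_prim.
by case: n {x_prim} => // n _; apply: contra_eq_neq => ->; rewrite expr0n eq_sym oner_eq0.
Qed.

Lemma prim_root_expB (E : fieldType) (n k : nat) (x : E) :
  n.-primitive_root x -> (k <= n)%N -> x ^+ (n - k) = x ^- k.
Proof.
move=> x_prim kn; rewrite expfB_cond ?(prim_expr_order x_prim) ?div1r //.
by rewrite (negPf (prim_root_neq0 x_prim)).
Qed.

Lemma prod_sub_prim_root (E : fieldType) (p : nat) (x : E) :
  p.-primitive_root x -> \prod_(1 <= j < p) (1 - x ^+ j) = p%:R.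
Proof.
move=> x_prim; have p_gt0 := prim_order_gt0 x_prim.
have : \prod_(1 <= j < p) ('X - (x ^+ j)%:P) = \sum_(i < p) 'X^i.
  apply: (@mulfI _ ('X - 1)); first by rewrite -polyC1 polyXsubC_eq0.
  by rewrite -subrX1 -(factor_Xn_sub_1 x_prim) [in RHS]big_ltn // expr0 polyC1.
move/(congr1 (fun q => q.[1])); rewrite horner_prod horner_sum.
under eq_bigr => j _ do rewrite hornerXsubC.
move=> ->; under eq_bigr => j _ do rewrite hornerXn expr1n.
by rewrite sumr_const card_ord.
Qed.

Lemma sum_prim_root (E : fieldType) (p n : nat) (x : E) :
  p.-primitive_root x -> ~~ (p %| n)%N -> \sum_(1 <= j < p) x ^+ (j * n) = -1.
Proof.
move=> x_prim pn; have p_gt0 := prim_order_gt0 x_prim.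
apply/eqP; rewrite eq_sym -subr_eq0 -opprD oppr_eq0; apply/eqP.
apply: (@mulfI _ (x ^+ n - 1)).
  by rewrite subr_eq0 -(prim_order_dvd x_prim).
rewrite mulr0; have <- : \sum_(i < p) (x ^+ n) ^+ i = 1 + \sum_(1 <= j < p) x ^+ (j * n).
  rewrite -(big_mkord xpredT (fun i => (x ^+ n) ^+ i)) big_ltn // expr0.
  by congr (_ + _); apply: eq_bigr => j _; rewrite -exprM mulnC.
by rewrite -subrX1 -exprM mulnC exprM (prim_expr_order x_prim) expr1n subrr.
Qed.

(** Pairs [j] with p - j, for p odd; with f j = z^j this passes from the
    cyclotomic field to its real subfield. *)
Lemma big_fold_half (T : Type) (idx : T) (op : Monoid.com_law idx) r (f : nat -> T) :
  \big[op/idx]_(1 <= j < r.*2.+1) f j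
    = \big[op/idx]_(k < r) op (f k.+1) (f (r.*2.+1 - k.+1)%N).
Proof.
rewrite (@big_cat_nat _ _ _ r.+1) //=; last by rewrite ltnS -addnn leq_addr.
rewrite [X in op _ X]big_nat_rev big_split; congr (op _ _).
  by rewrite big_add1 big_mkord.
rewrite -[X in index_iota X]add0n big_addn (_ : r.*2.+1 - r.+1 = r)%N; last by lia.
rewrite big_mkord; apply: eq_bigr => k _; congr f; lia.
Qed.

(** * The order Z[z + z^-1] at p *)

Section RealCyclotomicOrder.

Variables (L : fieldExtType rat) (z : L) (r : nat).
Hypotheses (p_prime : prime r.*2.+1) (z_prim : (r.*2.+1).-primitive_root z).

Local Notation p := r.*2.+1.
Local Notation evc q := (map_poly intr q).[z + z^-1].
Local Notation lam := (2 - (z + z^-1)).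

(** 2 - (z^k + z^-k) is the product of 1 - z^k and 1 - z^-k. *)
Lemma prod_lam_conj : \prod_(k < r) (2 - (z ^+ k.+1 + z ^- k.+1)) = p%:R :> L.
Proof.
rewrite -(prod_sub_prim_root z_prim) (@big_fold_half _ _ _ r (fun j => 1 - z ^+ j)).
apply: eq_bigr => k _.
rewrite (prim_root_expB z_prim); last by have := ltn_ord k; lia.
by move: (z ^+ k.+1) (expf_neq0 k.+1 (prim_root_neq0 z_prim)) => y y0 /=; field.
Qed.

(** Each of the two numbers is obtained from the other by raising the root of
    unity to a power: z^k from z, and z from z^k through an inverse of [k]
    modulo p. *)
Lemma lam_conj_assoc k : ~~ (p %| k)%N -> exists e e' : {poly int},
  2 - (z ^+ k + z ^- k) = lam * evc e /\ lam = (2 - (z ^+ k + z ^- k)) * evc e'.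
Proof.
move=> pk; have z0 := prim_root_neq0 z_prim.
have [Q QE] := two_sub_dickson_poly k.
have [k' kk'] : exists k', (k * k' = 1 %[mod p])%N.
  have kp : coprime k p by rewrite coprime_sym prime_coprime.
  have k_gt0 : (0 < k)%N by case: (k) pk => //; rewrite dvdn0.
  case: (egcdnP p k_gt0) => km kn; rewrite (eqP kp) => kE _.
  by exists km; rewrite mulnC kE modnMDl.
have [Q' Q'E] := two_sub_dickson_poly k'; have [D DE] := dickson_poly k.
exists Q, (Q' \Po D); split; first exact: QE.
rewrite map_comp_poly horner_comp DE //.
rewrite -Q'E ?expf_neq0 // -exprM.
have -> : z ^+ (k * k') = z.
  by rewrite -[RHS]expr1; apply/eqP; rewrite (eq_prim_root_expr z_prim); apply/eqP.
by [].
Qed.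

(** p is the norm of [lam], and the conjugates of [lam] are associates of it in
    the order: p is totally ramified. *)
Lemma lam_pow_assoc : exists e e' : {poly int},
  p%:R = lam ^+ r * evc e /\ lam ^+ r = p%:R * evc e'.
Proof.
have prod_ev (e : 'I_r -> {poly int}) : evc (\prod_k e k) = \prod_k evc (e k).
  by rewrite rmorph_prod horner_prod.
have : forall k : 'I_r, exists ee : {poly int} * {poly int},
    2 - (z ^+ k.+1 + z ^- k.+1) = lam * evc ee.1 /\
    lam = (2 - (z ^+ k.+1 + z ^- k.+1)) * evc ee.2.
  move=> k; have [|e [e' ?]] := @lam_conj_assoc k.+1; last by exists (e, e').
  by apply: contraL (ltn_ord k) => /(dvdn_leq (ltn0Sn _)); lia.
case/choice=> ee eeE; exists (\prod_k (ee k).1), (\prod_k (ee k).2).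
have lamr : lam ^+ r = \prod_(k < r) lam by rewrite prodr_const card_ord.
rewrite !prod_ev -prod_lam_conj lamr -!big_split /=.
by split; apply: eq_bigr => k _; case: (eeE k).
Qed.

Lemma integral_two_cos k : algebraic_integer (z ^+ k + z ^- k).
Proof.
have unity_int (y : L) : y ^+ p = 1 -> algebraic_integer y.
  move=> yp; exists ('X^p - 1); first exact: monicXnsubC.
  by rewrite rmorphB rmorph1 /= map_polyXn /root !hornerE yp subrr.
apply: integral_add; apply: unity_int.
  by rewrite exprAC (prim_expr_order z_prim) expr1n.
by rewrite exprVn exprAC (prim_expr_order z_prim) expr1n invr1.
Qed.

Lemma integral_evc q : algebraic_integer (evc q).
Proof.
apply: integral_horner; last by have := integral_two_cos 1; rewrite !expr1.
by apply/integral_poly => i; rewrite coef_map; apply: integral_id.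
Qed.

(** The order is maximal at p. Divide p x by [lam] one step at a time: modulo
    [lam] an element of the order is an integer [b], and as long as fewer than
    [r] factors are extracted, [b] is [lam] times an algebraic integer. Then
    b^r is p times an algebraic integer, so that p divides [b] and [lam] can be
    extracted once more. In the end lam^r, an associate of p, divides p x. *)
Lemma real_cyclotomic_order_saturated x : algebraic_integer x ->
  (exists q, p%:R * x = evc q) -> exists q, x = evc q.
Proof.
move=> x_int [q0 pxE].
have [e [e' [pE lamE]]] := lam_pow_assoc.
have p0 : (p%:R : L) != 0 by rewrite -(rmorph_nat (in_alg L)) fmorph_eq0 pnatr_eq0.
have lam0 : lam != 0.
  apply/eqP => lam0; move/eqP: p0; apply; rewrite pE lam0 expr0n.
  by have := prime_gt1 p_prime; case: (r) => // r' _; rewrite mul0r.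
have evc_lam i : evc ((2%:P - 'X) ^+ i) = lam ^+ i.
  by rewrite rmorphXn /= horner_exp rmorphB /= map_polyX map_polyC !hornerE.
suffices lam_dvd k : (k <= r)%N -> exists q, p%:R * x = lam ^+ k * evc q.
  have [q qE] := lam_dvd r (leqnn r); exists (e' * q).
  by apply: (mulfI p0); rewrite qE lamE rmorphM hornerM mulrA.
elim: k => [|k IHk] kr; first by exists q0; rewrite mul1r.
have [q qE] := IHk (ltnW kr).
(* Since z + z^-1 = 2 - lam, reduction modulo [lam] is evaluation at 2. *)
have /factor_theorem[q1 q1E] : root (q - q.[2]%:P) 2.
  by rewrite /root hornerD hornerN hornerC subrr.
pose b := q.[2].
have evq : evc q = b%:~R - lam * evc q1.
  have -> : q = b%:P + q1 * ('X - 2%:P) by rewrite -q1E addrC subrK.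
  rewrite rmorphD rmorphM /= rmorphB /= map_polyX !map_polyC !hornerE /=.
  by rewrite -[2%:~R]/(2%:R : L); ring.
pose o := lam ^+ (r - k.+1) * evc e * x + evc q1.
have o_int : algebraic_integer o.
  apply: integral_add; last exact: integral_evc.
  apply: integral_mul x_int; apply: integral_mul; last exact: integral_evc.
  by rewrite -evc_lam; apply: integral_evc.
have bE : b%:~R = lam * o.
  apply: (mulfI (expf_neq0 k lam0)); rewrite /o.
  have := qE; rewrite evq pE -[in lam ^+ r](subnKC kr) exprD exprS => {}qE.
  have -> : lam ^+ k * b%:~R = lam ^+ k * (b%:~R - lam * evc q1) + lam ^+ k * (lam * evc q1).
    by ring.
  by rewrite -qE; ring.
(* The rational number b^r / p is an algebraic integer. *)
have [b' b'E] : exists b' : int, b = p%:Z * b'.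
  have [|m mE] := @integralOver_int_rat algC ((b ^+ r)%:~R / p%:R).
    have [eps] := number_field_embedding L.
    have -> : ratr ((b ^+ r)%:~R / p%:R) = eps (evc e' * o ^+ r).
      apply: (mulfI (_ : p%:R != 0 :> algC)); first by rewrite pnatr_eq0.
      transitivity (eps (b ^+ r)%:~R).
        by rewrite fmorph_div !rmorph_int rmorph_nat mulrC divfK // pnatr_eq0.
      by rewrite -(rmorph_nat eps) -rmorphM [_ * (_ * _)]mulrA -lamE -exprMn -bE rmorphXn.
    apply: integralOver_int_rmorph; apply: integral_mul; first exact: integral_evc.
    exact: algebraic_integerX.
  have pbr : (p %| b ^+ r)%Z.
    apply/dvdzP; exists m; apply: (@intr_inj rat).
    by rewrite rmorphM /= -mE -pmulrn divfK // pnatr_eq0.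
  have : (p %| b)%Z.
    move: pbr; rewrite !dvdzE abszX /= Euclid_dvdX //.
    by case/andP.
  by case/dvdzP=> b' ->; exists b'; rewrite mulrC.
exists ((2%:P - 'X) ^+ r.-1 * e * b'%:P - q1).
rewrite qE evq b'E exprSr -mulrA; congr (_ * _).
rewrite rmorphB !rmorphM /= map_polyC hornerD hornerN !hornerM hornerC evc_lam /=.
rewrite -pmulrn pE -[in lam ^+ r](ltn_predK kr) exprS.
by ring.
Qed.

End RealCyclotomicOrder.

(** * Integral spans *)

Section ZSpan.

Variables (V : zmodType) (n : nat) (b : 'I_n -> V).

Definition Z_span (x : V) := exists c : 'I_n -> int, x = \sum_i b i *~ c i.

Lemma Z_spanD x y : Z_span x -> Z_span y -> Z_span (x + y).
Proof.
move=> [c ->] [d ->]; exists (fun i => c i + d i).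
by rewrite -big_split; apply: eq_bigr => i _; rewrite mulrzDr.
Qed.

Lemma Z_spanMz x m : Z_span x -> Z_span (x *~ m).
Proof.
move=> [c ->]; exists (fun i => c i * m).
by rewrite mulrz_suml; apply: eq_bigr => i _; rewrite mulrzA.
Qed.

Lemma Z_spanN x : Z_span x -> Z_span (- x).
Proof. by move/(@Z_spanMz _ (-1)); rewrite mulrN1z. Qed.

Lemma Z_span0 : Z_span 0.
Proof. by exists (fun=> 0); rewrite big1 // => i _; rewrite mulr0z. Qed.

Lemma Z_span_sum (I : Type) (s : seq I) (P : pred I) (f : I -> V) :
  (forall i, P i -> Z_span (f i)) -> Z_span (\sum_(i <- s | P i) f i).
Proof. by move=> Pf; elim/big_rec: _ => [|i x /Pf]; [exact: Z_span0 | exact: Z_spanD]. Qed.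

Lemma Z_span_base i : Z_span (b i).
Proof.
exists (fun j => (j == i)%:R); rewrite (bigD1 i) //= eqxx mulr1z big1 ?addr0 //.
by move=> j /negPf ->; rewrite mulr0z.
Qed.

End ZSpan.

(** * The field Q+, its basis and its real embeddings *)

Section RealCyclotomicField.

Variables (L : fieldExtType rat) (z : L) (r : nat).
Hypotheses (p_prime : prime r.*2.+1) (z_prim : (r.*2.+1).-primitive_root z).
Hypothesis r_gt1 : (1 < r)%N.

Local Notation p := r.*2.+1.
Local Notation F := (Qplus z).

Definition two_cos (k : nat) : F := vsproj _ (z ^+ k + z ^- k).

Lemma val_two_cos k : vsval (two_cos k) = z ^+ k + z ^- k.
Proof.
have [D DE] := dickson_poly k.
rewrite vsprojK // -DE ?(prim_root_neq0 z_prim) // rpred_horner ?memv_adjoin //.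
by apply/polyOverP => i; rewrite coef_map rpred_int.
Qed.

Lemma Qplus_genE : Qplus_gen z = two_cos 1.
Proof. by rewrite /two_cos expr1. Qed.

Lemma val_horner_Qplus_gen q :
  vsval (map_poly intr q).[Qplus_gen z] = (map_poly intr q).[z + z^-1].
Proof.
rewrite -horner_map -map_poly_comp Qplus_genE [GRing.RMorphism.sort _ _]val_two_cos expr1.
by congr _.[_]; apply: eq_map_poly => a /=; rewrite rmorph_int.
Qed.

Lemma two_cosM j k : (k <= j)%N ->
  two_cos j * two_cos k = two_cos (j + k) + two_cos (j - k).
Proof.
move=> kj; have [i ->] : exists i, j = (i + k)%N by exists (j - k)%N; rewrite subnK.
apply: val_inj; rewrite [LHS]rmorphM [RHS]rmorphD /= !val_two_cos addnK !exprD.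
have z0 n := expf_neq0 n (prim_root_neq0 z_prim).
by move: (z ^+ k) (z ^+ i) (z0 k) (z0 i) => x y x0 y0; field; rewrite x0 y0.
Qed.

Lemma two_cos0 : two_cos 0 = 2.
Proof.
by apply: val_inj; rewrite [LHS]val_two_cos expr0 invr1 [RHS]rmorph_nat.
Qed.

Lemma sum_two_cos : \sum_(k < r) two_cos k.+1 = -1.
Proof.
apply: val_inj; rewrite [LHS]rmorph_sum [RHS]rmorphN1 /=.
have /(sum_prim_root z_prim) <- : ~~ (p %| 1)%N.
  by rewrite dvdn1; case: (r) r_gt1.
rewrite (@big_fold_half _ _ _ r (fun j => z ^+ (j * 1))); apply: eq_bigr => k _.
by rewrite !muln1 val_two_cos (prim_root_expB z_prim) //; have := ltn_ord k; lia.
Qed.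

Lemma Qplus_basis0 : Qplus_basis z 0 = 1.
Proof. by []. Qed.

Lemma Qplus_basisS k : Qplus_basis z k.+1 = two_cos k.+1.
Proof. by []. Qed.

Local Notation b := (fun i : 'I_r => Qplus_basis z i).

Let b_span k : (k < r)%N -> Z_span b (Qplus_basis z k).
Proof. by move=> kr; apply: (Z_span_base b (Ordinal kr)). Qed.

(** The only case outside the basis besides [two_cos 0] = 2 is k = r, which is
    eliminated by the vanishing of the sum of all p-th roots of unity. *)
Lemma two_cos_Z_span k : (k <= r)%N -> Z_span b (two_cos k).
Proof.
have one_span : Z_span b 1 by apply: (@b_span 0); lia.
case: k => [|k] kr.
  by rewrite two_cos0 -[2]/(1 + 1); apply: Z_spanD.
have [kr' | rk] := ltnP k.+1 r; first by rewrite -Qplus_basisS; apply: b_span.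
have -> : two_cos k.+1 = - (1 + \sum_(i < k) two_cos i.+1).
  have rE : r = k.+1 by apply/eqP; rewrite eqn_leq rk kr.
  have := sum_two_cos; rewrite rE big_ord_recr /= => /eqP.
  by rewrite addrC -subr_eq0 opprK -addrA addr_eq0 addrC => /eqP.
apply: Z_spanN; apply: Z_spanD => //; apply: Z_span_sum => i _.
by rewrite -Qplus_basisS; apply: b_span; apply: leq_trans kr; rewrite ltnS.
Qed.

(** The span of the basis is stable under multiplication by z + z^-1. *)
Lemma Aplus_Z_span x : Aplus x -> Z_span b x.
Proof.
have one_span : Z_span b 1 by apply: (@b_span 0); lia.
have mul_gen y : Z_span b y -> Z_span b (Qplus_gen z * y).
  move=> [c ->]; rewrite mulr_sumr; apply: Z_span_sum => i _.
  rewrite mulrzAr; apply: Z_spanMz; rewrite Qplus_genE.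
  case: i => -[|k] kr /=.
    by rewrite Qplus_basis0 mulr1; apply: two_cos_Z_span; lia.
  rewrite Qplus_basisS mulrC two_cosM // addn1 subn1.
  by apply: Z_spanD; apply: two_cos_Z_span; lia.
move=> [q ->]; elim/poly_ind: q => [|q a IHq].
  by rewrite rmorph0 horner0; apply: Z_span0.
rewrite rmorphD rmorphM /= map_polyX map_polyC hornerMXaddC mulrC.
by apply: Z_spanD; [apply: mul_gen | apply: Z_spanMz].
Qed.

Lemma Qplus_basis_Aplus k : Aplus (Qplus_basis z k).
Proof.
case: k => [|k]; first by exists 1; rewrite rmorph1 hornerC.
have [D DE] := dickson_poly k.+1; exists D; apply: val_inj.
by rewrite [RHS]val_horner_Qplus_gen DE ?(prim_root_neq0 z_prim) // [LHS]val_two_cos.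
Qed.

Lemma Z_span_Aplus x : Z_span b x -> Aplus x.
Proof.
have /choice[q qE] := fun i : 'I_r => Qplus_basis_Aplus i.
move=> [c ->]; exists (\sum_i q i *~ c i).
rewrite rmorph_sum horner_sum; apply: eq_bigr => i _.
by rewrite rmorphMz /= hornerMz -qE.
Qed.

(** Clear denominators in the coefficients and use [Aplus_Z_span]. *)
Lemma Qplus_basis_spanning : Q_spanning b.
Proof.
move=> x; have /Fadjoin1_polyP[q xE] := valP x.
have [q' [a a0 qE]] := rat_poly_scale q.
have /Aplus_Z_span[c xaE] : Aplus (x *~ a).
  exists q'; apply: val_inj; rewrite [RHS]val_horner_Qplus_gen [LHS]rmorphMz /=.
  rewrite xE qE linearZ /= hornerZ -map_poly_comp.
  rewrite (eq_map_poly (_ : _ =1 intr)); last by move=> i /=; rewrite scaler_int.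
  rewrite -mulrzl mulrA -(rmorph_int (in_alg L)) -rmorphM divff ?rmorph1 ?mul1r //.
  by rewrite intr_eq0.
exists (fun k => (c k)%:~R / a%:~R).
have -> : x = a%:~R^-1 *: (x *~ a).
  by rewrite -scaler_int scalerA mulVf ?scale1r // intr_eq0.
rewrite xaE scaler_sumr; apply: eq_bigr => k _.
by rewrite -scaler_int scalerA mulrC.
Qed.

(** Restrictions to Q+ of an embedding of L followed by the automorphisms
    w |-> w^(i+1); that these exist is the irreducibility of the cyclotomic
    polynomial. *)
Lemma Qplus_embeddings : exists (w : algC) (s : 'I_r -> {rmorphism F -> algC}),
  p.-primitive_root w /\ forall i k, s i (two_cos k) = w ^+ (i.+1 * k) + w ^- (i.+1 * k).
Proof.
have [eps] := number_field_embedding L.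
have u_ex (i : 'I_r) : exists u : {rmorphism algC -> algC},
    forall y, y ^+ p = 1 -> u y = y ^+ i.+1.
  have cop : coprime i.+1 p.
    rewrite coprime_sym prime_coprime //.
    by apply: contraL (ltn_ord i) => /(dvdn_leq (ltn0Sn _)); lia.
  by have [u uE] := Qn_aut_exists cop; exists u.
have [u uE] := choice u_ex; exists (eps z).
exists (fun i => u i \o (eps \o (vsval : F -> L))).
split=> [|i k]; first by rewrite fmorph_primitive_root.
rewrite /= val_two_cos rmorphD fmorphV !rmorphXn rmorphD fmorphV !rmorphXn /=.
rewrite uE -?exprM //.
by rewrite -rmorphXn (prim_expr_order z_prim) rmorph1.
Qed.

Section QplusEmbeddings.

Variables (w : algC) (s : 'I_r -> {rmorphism F -> algC}).
Hypothesis w_prim : p.-primitive_root w.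
Hypothesis sE : forall i k, s i (two_cos k) = w ^+ (i.+1 * k) + w ^- (i.+1 * k).

Lemma Qplus_embeddings_inj i j : s i =1 s j -> i = j.
Proof.
move=> /(_ (two_cos 1)); rewrite !sE !muln1 => /eqP.
have w0 k : w ^+ k != 0 by rewrite expf_neq0 // (prim_root_neq0 w_prim).
rewrite -subr_eq0.
have -> : w ^+ i.+1 + w ^- i.+1 - (w ^+ j.+1 + w ^- j.+1)
   = (w ^+ i.+1 - w ^+ j.+1) * (1 - w ^- (i.+1 + j.+1)).
  rewrite exprD; move: (w ^+ i.+1) (w ^+ j.+1) (w0 i.+1) (w0 j.+1) => x y x0 y0.
  by field; rewrite x0 y0.
rewrite mulf_eq0 !subr_eq0 (eq_prim_root_expr w_prim) => /orP[|].
  have [ir jr] := (ltn_ord i, ltn_ord j).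
  rewrite !modn_small; last 2 first; try lia.
  by move=> /eqP[] ?; apply: val_inj.
rewrite eq_sym invr_eq1 -(prim_order_dvd w_prim) => /(dvdn_leq _).
by have [ir jr] := (ltn_ord i, ltn_ord j); lia.
Qed.

(** Squeezed between [r] distinct embeddings and [r] spanning vectors. *)
Lemma dim_Qplus : \dim {:F} = r.
Proof.
apply/eqP; rewrite eqn_leq (emb_le_spanning Qplus_embeddings_inj (@vbasis_spanning _)).
rewrite andbT -[leqRHS]card_ord cardE -(size_map b); apply: leq_trans (dim_span _).
apply/dimvS/subvP => x _; have [c ->] := Qplus_basis_spanning x.
apply: memv_suml => k _; apply/memvZ/memv_span/mapP.
by exists k; rewrite ?mem_enum.
Qed.

Let card_r : #|'I_r| = \dim {:F}. Proof. by rewrite dim_Qplus card_ord. Qed.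

Lemma trace_two_cos k : field_trace (two_cos k) = if (p %| k)%N then r.*2%:R else -1.
Proof.
apply: (fmorph_inj (ratr : rat -> algC)).
rewrite [LHS](ratr_field_trace Qplus_embeddings_inj card_r).
under eq_bigr => i _ do rewrite sE.
case: ifPn => pk.
  rewrite rmorph_nat -addnn natrD -[in RHS](card_ord r) -sumr_const -big_split.
  apply: eq_bigr => i _; rewrite mulnC exprM.
  have /eqP -> : w ^+ k == 1 by rewrite -(prim_order_dvd w_prim).
  by rewrite expr1n invr1.
rewrite rmorphN1 -(sum_prim_root w_prim pk).
rewrite (@big_fold_half _ _ _ r (fun j => w ^+ (j * k))); apply: eq_bigr => i _.
rewrite !exprM (prim_root_expB w_prim) ?exprVn //; have := ltn_ord i; lia.
Qed.

End QplusEmbeddings.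

End RealCyclotomicField.

(** * Z-bases and the discriminant *)

Lemma Z_basis_mem (V : zmodType) n (S : set V) (b : 'I_n -> V) i :
  Z_basis S b -> S (b i).
Proof. by move=> Sb; apply/(Sb.1 _); apply: Z_span_base. Qed.

(** The two matrices of coordinates are inverse to each other by uniqueness of
    coordinates in [b']. *)
Lemma Z_basis_change (V : zmodType) n (S : set V) (b b' : 'I_n -> V) :
  Z_basis S b -> Z_basis S b' ->
  exists2 U : 'M[int]_n, U \in unitmx & forall i, b' i = \sum_k b k *~ U i k.
Proof.
move=> Sb Sb'.
have coords (e e' : 'I_n -> V) : Z_basis S e -> Z_basis S e' ->
    exists U : 'M[int]_n, forall i, e' i = \sum_k e k *~ U i k.
  move=> Se Se'; have /choice[c cE] := fun i => (Se.1 (e' i)).1 (Z_basis_mem i Se').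
  by exists (\matrix_(i, k) c i k) => i; rewrite cE; apply: eq_bigr => k _; rewrite mxE.
have [[U UE] [U' U'E]] := (coords _ _ Sb Sb', coords _ _ Sb' Sb); exists U => //.
suffices /mulmx1_unit[] : U *m U' = 1%:M by [].
apply/matrixP => i k; apply/eqP; rewrite -subr_eq0; apply/eqP.
pose c k := (U *m U') i k - (1%:M : 'M[int]_n) i k.
apply: (Sb'.2 c) k; under eq_bigr => k _ do rewrite /c mulrzBr.
rewrite sumrB; apply/eqP; rewrite subr_eq0; apply/eqP.
transitivity (b' i); last first.
  rewrite (bigD1 i) //= !mxE eqxx mulr1z big1 ?addr0 // => k ki.
  by rewrite !mxE eq_sym (negPf ki) mulr0z.
rewrite UE; under [RHS]eq_bigr => l _ do rewrite U'E mulrz_suml.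
rewrite [RHS]exchange_big /=; apply: eq_bigr => k _; rewrite mxE mulrz_sumr.
by apply: eq_bigr => l _; rewrite mulrC mulrzA.
Qed.

Lemma unitmx_int_norm_det (R : numDomainType) n (U : 'M[int]_n) :
  U \in unitmx -> `|\det (map_mx intr U : 'M[R]_n)| = 1.
Proof.
rewrite unitmxE det_map_mx -intr_norm => U_unit.
suffices -> : `|\det U| = 1 by [].
by move: U_unit; rewrite unfold_in => /orP[] /eqP ->.
Qed.

Section Discriminant.

Variable F : fieldExtType rat.

Lemma field_traceE x :
  field_trace x = \sum_i coord (vbasis {:F}) i (x * (vbasis {:F})`_i).
Proof.
by apply: eq_bigr => i _; rewrite !mxE /= passmx.vecof_delta lfunE.
Qed.

Lemma field_trace_lincomb n (c : 'I_n -> rat) (b : 'I_n -> F) :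
  field_trace (\sum_k c k *: b k) = \sum_k c k * field_trace (b k).
Proof.
under [RHS]eq_bigr => k _ do rewrite field_traceE mulr_sumr.
rewrite exchange_big field_traceE; apply: eq_bigr => i _.
rewrite mulr_suml linear_sum; apply: eq_bigr => k _.
by rewrite -scalerAl linearZ.
Qed.

Lemma field_traceD (x y : F) : field_trace (x + y) = field_trace x + field_trace y.
Proof.
rewrite !field_traceE -big_split; apply: eq_bigr => i _.
by rewrite mulrDl linearD.
Qed.

Lemma trace_gram_change n (U : 'M[int]_n) (b b' : 'I_n -> F) :
  (forall i, b' i = \sum_k b k *~ U i k) ->
  trace_gram b' = map_mx intr U *m trace_gram b *m (map_mx intr U)^T.
Proof.
move=> b'E; apply/matrixP => i j; rewrite !mxE.
have toQ k : b' k = \sum_l (U k l)%:~R *: b l.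
  by rewrite b'E; apply: eq_bigr => l _; rewrite scaler_int.
rewrite [in b' j]toQ mulr_sumr.
under eq_bigr => l _ do rewrite -scalerAr.
rewrite field_trace_lincomb; apply: eq_bigr => l _; rewrite !mxE mulrC; congr (_ * _).
rewrite toQ mulr_suml; under eq_bigr => k _ do rewrite -scalerAl.
by rewrite field_trace_lincomb; apply: eq_bigr => k _; rewrite !mxE.
Qed.

(** A change of Z-basis multiplies the Gram determinant by the square of a
    unimodular determinant, so the value chosen by [xget] is any of them. *)
Lemma discriminantE n (b : 'I_n -> F) : \dim {:F} = n ->
  Z_basis [set x | algebraic_integer x]%classic b ->
  discriminant F = \det (trace_gram b).
Proof.
move=> dimF; case: n / dimF b => b b_basis.
apply: xget_subset1; first by exists b.
have indep (b' : 'I_(\dim {:F}) -> F) : Z_basis [set x | algebraic_integer x]%classic b' ->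
    \det (trace_gram b') = \det (trace_gram b).
  move=> b'_basis; have [U U_unit b'E] := Z_basis_change b_basis b'_basis.
  have := unitmx_int_norm_det rat U_unit.
  rewrite (trace_gram_change b'E) !det_mulmx det_tr mulrAC -expr2.
  by rewrite -real_normK ?num_real // => ->; rewrite expr1n mul1r.
by move=> _ _ [b1 [/indep b1E ->]] [b2 [/indep b2E ->]]; rewrite b1E b2E.
Qed.

Lemma trace_gram_emb (C : numFieldType) (T : finType) n (s : T -> {rmorphism F -> C})
    (s_inj : forall i j, s i =1 s j -> i = j) (cardT : #|T| = \dim {:F}) (b : 'I_n -> F) :
  map_mx ratr (trace_gram b) = \matrix_(i, j) \sum_t s t (b i) * s t (b j).
Proof.
apply/matrixP => i j; rewrite !mxE (ratr_field_trace s_inj cardT).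
by apply: eq_bigr => t _; rewrite rmorphM.
Qed.

End Discriminant.

(** * The ring of integers of Q+ *)

Section RealCyclotomicInteger.

Variables (L : fieldExtType rat) (z : L) (r : nat).
Hypotheses (p_prime : prime r.*2.+1) (z_prim : (r.*2.+1).-primitive_root z).
Hypothesis r_gt1 : (1 < r)%N.

Local Notation p := r.*2.+1.
Local Notation F := (Qplus z).
Local Notation b := (fun i : 'I_r => Qplus_basis z i).

Section QplusEmbeddings.

Variables (w : algC) (s : 'I_r -> {rmorphism F -> algC}).
Hypothesis w_prim : p.-primitive_root w.
Hypothesis sE : forall i k, s i (two_cos z k) = w ^+ (i.+1 * k) + w ^- (i.+1 * k).

Let s_inj := Qplus_embeddings_inj p_prime z_prim r_gt1 w_prim sE.
Let dimF := dim_Qplus p_prime z_prim r_gt1 w_prim sE.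
Let card_r : #|'I_r| = \dim {:F}. Proof. by rewrite dimF card_ord. Qed.

Lemma Qplus_basis_unitmx : emb_mx s b \in unitmx.
Proof. exact/emb_mx_spanning_unit/Qplus_basis_spanning. Qed.

(** All conjugates of the basis are real, so the determinant is the square of a
    nonzero real number. *)
Lemma Qplus_gram_gt0 : 0 < \det (Qplus_gram z r).
Proof.
rewrite -(ltr0q algC) -det_map_mx.
have -> : map_mx ratr (Qplus_gram z r) = emb_mx s b *m (emb_mx s b)^T.
  by rewrite (trace_gram_emb s_inj card_r); apply/matrixP => i j; rewrite !mxE;
    apply: eq_bigr => t _; rewrite !mxE.
rewrite det_mulmx det_tr -expr2.
have P_real : \det (emb_mx s b) \is Num.real.
  rewrite CrealE -det_map_mx; apply/eqP; congr (\det _).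
  apply/matrixP => k i; rewrite !mxE; apply/eqP; case: k => -[|k] kr /=.
    by rewrite Qplus_basis0 !rmorph1.
  have w_norm n : (w ^+ n)^* = w ^- n.
    have w1 : `|w| = 1.
      apply/eqP; rewrite -(@pexpr_eq1 _ _ p) // -normrX.
      by rewrite (prim_expr_order w_prim) normr1.
    by rewrite [RHS]invC_norm normrX w1 !expr1n invr1 mul1r.
  by rewrite Qplus_basisS sE rmorphD fmorphV /= w_norm invrK addrC.
rewrite lt_def sqrf_eq0 -unitfE -unitmxE Qplus_basis_unitmx /=.
by rewrite real_exprn_even_ge0.
Qed.

Lemma Qplus_basis_free : Q_free b.
Proof. exact/emb_mx_unit_free/Qplus_basis_unitmx. Qed.

Lemma Qplus_basis_Z_basis : Z_basis (@Aplus L z) b.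
Proof.
split=> [x|c c0 i]; first by split=> [/Aplus_Z_span|/Z_span_Aplus]; apply.
have : \sum_k (c k)%:~R *: Qplus_basis z k = 0.
  by rewrite -[RHS]c0; apply: eq_bigr => k _; rewrite scaler_int.
by move/Qplus_basis_free => /(_ i) /eqP; rewrite intr_eq0 => /eqP.
Qed.

Lemma trace_two_cosM (j k : 'I_r) :
  field_trace (two_cos z j.+1 * two_cos z k.+1) = (j == k)%:R * p%:R - 2.
Proof.
wlog kj : j k / (k <= j)%N.
  by move=> IH; case: (leqP k j) => [|/ltnW] /IH //; rewrite mulrC eq_sym.
have [jr kr] := (ltn_ord j, ltn_ord k).
rewrite (two_cosM z_prim) // field_traceD !(trace_two_cos p_prime z_prim r_gt1 w_prim sE) subSS.
case: ifP => [/dvdn_leq|_]; first by lia.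
have [-> | jk] := eqVneq j k.
  by rewrite subnn dvdn0 mul1r -[p%:R]natr1 addrC -addrA.
rewrite (_ : (p %| j - k)%N = false); first by rewrite mul0r sub0r.
have jk' : j != k :> nat by [].
by apply/negP => /dvdn_leq; lia.
Qed.

Lemma trace1 : field_trace (1 : F) = r%:R.
Proof.
apply: (fmorph_inj (ratr : rat -> algC)).
rewrite [LHS](ratr_field_trace s_inj card_r) rmorph_nat.
by under eq_bigr => i _ do rewrite rmorph1; rewrite sumr_const card_ord.
Qed.

(** If x is the sum of the a_m (z^m + z^-m) for 1 <= m <= r, the m-th coefficient
    here is p a_m: the trace form has matrix p I - 2 J in these vectors, and -2
    times the trace of [x] cancels the contribution of J. For integral [x] all
    coefficients are integers, so the denominators of [x] divide p. *)
Lemma two_cos_expansion x :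
  p%:R * x = \sum_(m < r) (field_trace (x * two_cos z m.+1) - 2 * field_trace x)
                            *: two_cos z m.+1.
Proof.
have [c ->] := Qplus_basis_spanning p_prime z_prim r_gt1 x.
under [RHS]eq_bigr => m _.
  rewrite mulr_suml; under eq_bigr => k _ do rewrite -scalerAl.
  rewrite !field_trace_lincomb mulr_sumr -sumrB scaler_suml.
  under eq_bigr => k _ do rewrite mulrCA -mulrBr -scalerA.
  over.
rewrite [RHS]exchange_big mulr_sumr; apply: eq_bigr => k _.
rewrite -scaler_sumr -scalerAr; congr (_ *: _).
have scale_p (y : F) : p%:R * y = p%:R *: y by rewrite scaler_nat mulr_natl.
case: k => -[|k] kr /=.
  rewrite Qplus_basis0 trace1.
  under eq_bigr => m _.
    rewrite mul1r (trace_two_cos p_prime z_prim r_gt1 w_prim sE).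
    rewrite (_ : (p %| m.+1)%N = false); last first.
      by apply/negP => /(dvdn_leq (ltn0Sn _)); have := ltn_ord m; lia.
    over.
  rewrite -scaler_sumr sum_two_cos // scale_p scalerN -scaleNr; congr (_ *: _).
  by rewrite -natr1 -mul2n natrM; ring.
rewrite Qplus_basisS (trace_two_cos p_prime z_prim r_gt1 w_prim sE).
rewrite (_ : (p %| k.+1)%N = false); last first.
  by apply/negP => /(dvdn_leq (ltn0Sn _)); lia.
pose k' := Ordinal (ltnW kr); rewrite -[k in two_cos z k.+1]/(k' : nat).
under eq_bigr => m _ do rewrite trace_two_cosM.
rewrite (bigD1 k') //= eqxx big1 ?addr0 => [|m mk].
  by rewrite scale_p mul1r mulrN1 opprK subrK.
by rewrite eq_sym (negPf mk) mul0r sub0r mulrN1 opprK addNr scale0r.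
Qed.

Lemma Qplus_integralP (x : F) : algebraic_integer x <-> Aplus x.
Proof.
split=> [x_int | [q ->]]; last first.
  apply: (integralOver_int_fmorph (f := vsval : {rmorphism F -> L})).
  by rewrite /= (val_horner_Qplus_gen z_prim); exact: (integral_evc z_prim q).
have c_int k : algebraic_integer (two_cos z k).
  apply: (integralOver_int_fmorph (f := vsval : {rmorphism F -> L})).
  by rewrite /= (val_two_cos z_prim); exact: (integral_two_cos z_prim k).
have coef_int (m : 'I_r) : exists t : int,
    field_trace (x * two_cos z m.+1) - 2 * field_trace x = t%:~R.
  have [t tE] := integral_field_trace s_inj card_r x_int.
  have [u uE] := integral_field_trace s_inj card_r (integral_mul x_int (c_int m.+1)).
  by exists (u - 2 * t); rewrite uE tE rmorphB rmorphM.
have [t tE] := choice coef_int.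
have /(Z_span_Aplus z_prim)[q qE] : Z_span b (p%:R * x).
  rewrite two_cos_expansion; apply: Z_span_sum => m _; rewrite tE scaler_int.
  by apply/Z_spanMz/two_cos_Z_span.
have [||q' q'E] := @real_cyclotomic_order_saturated L z r p_prime z_prim (vsval x).
- exact: integralOver_int_rmorph.
- by exists q; rewrite -(val_horner_Qplus_gen z_prim) -qE rmorphM rmorph_nat.
by exists q'; apply: val_inj; rewrite [RHS](val_horner_Qplus_gen z_prim).
Qed.

End QplusEmbeddings.

(** Summary in which the auxiliary embeddings of Q+ no longer appear. *)
Lemma Qplus_integral_structure : [/\ Q_spanning b, Q_free b, Z_basis (@Aplus L z) b,
   discriminant F = \det (Qplus_gram z r) & 0 < \det (Qplus_gram z r)].
Proof.
have [w [s [w_prim sE]]] := Qplus_embeddings p_prime z_prim r_gt1.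
split.
- exact: Qplus_basis_spanning.
- exact: Qplus_basis_free sE.
- exact: Qplus_basis_Z_basis sE.
- apply: discriminantE; first exact: dim_Qplus sE.
  have [b_gen b_free] := Qplus_basis_Z_basis w_prim sE.
  by split=> // x; rewrite -b_gen; apply: Qplus_integralP sE _.
- exact: Qplus_gram_gt0 sE.
Qed.

End RealCyclotomicInteger.

Import ComplexField.Normc.

(** * Product formula and Kronecker's theorem *)

Section IntegralUnits.

Variable F : fieldExtType rat.

Lemma integral_unit1 : integral_unit (1 : F).
Proof. by split; rewrite ?invr1 ?oner_neq0 //; apply: integral1. Qed.

Lemma integral_unitM (x y : F) :
  integral_unit x -> integral_unit y -> integral_unit (x * y).
Proof.
move=> [x0 x_int xV_int] [y0 y_int yV_int]; split; first by rewrite mulf_neq0.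
  exact: integral_mul.
by rewrite invfM; apply: integral_mul.
Qed.

Lemma integral_unitV (x : F) : integral_unit x -> integral_unit x^-1.
Proof. by move=> [x0 x_int xV_int]; split; rewrite ?invr_eq0 ?invrK. Qed.

Lemma integral_unitXz (x : F) (m : int) : integral_unit x -> integral_unit (x ^ m).
Proof.
move=> x_unit; have xX n : integral_unit (x ^+ n).
  elim: n => [|n IHn]; first exact: integral_unit1.
  by rewrite exprS; apply: integral_unitM.
by case: m => n; [apply: xX | apply/integral_unitV/xX].
Qed.

Lemma integral_unit_prod n (u : 'I_n -> F) (c : 'I_n -> int) :
  (forall i, integral_unit (u i)) -> integral_unit (\prod_i u i ^ c i).
Proof.
move=> u_unit; elim/big_rec: _ => [|i x _ x_unit]; first exact: integral_unit1.
by apply: integral_unitM => //; apply: integral_unitXz.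
Qed.

End IntegralUnits.

Section AbsoluteValues.

Variables (R : realType) (F : fieldExtType rat) (T : finType).
Variable s : T -> {rmorphism F -> R[i]}.
Hypotheses (s_inj : forall i j, s i =1 s j -> i = j) (cardT : #|T| = \dim {:F}).

Lemma normc_real (x : R) : normc (real_complex R x) = `|x|.
Proof. by rewrite /normc /= expr0n addr0 sqrtr_sqr. Qed.

Lemma normc_int (m : int) : normc (m%:~R : R[i]) = `|m|%:~R.
Proof. by rewrite -(rmorph_int (real_complex R)) normc_real intr_norm. Qed.

Lemma normc_ge0 (x : R[i]) : 0 <= normc x.
Proof. by case: x => a b; apply: sqrtr_ge0. Qed.

Lemma normc_gt0 (x : R[i]) : x != 0 -> 0 < normc x.
Proof.
move=> x0; rewrite lt_def; apply/andP; split; last exact: normc_ge0.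
by apply: contraNneq x0 => /eq0_normc ->.
Qed.

Lemma integral_prod_normc x : algebraic_integer x ->
  exists m : int, \prod_t normc (s t x) = `|m|%:~R.
Proof.
move=> /(integral_prod_emb s_inj cardT)[m mE]; exists m; rewrite -normc_int -mE.
by rewrite (big_morph (@normc R) (@normcM R) (@normc1 R)).
Qed.

Lemma integral_unit_product_formula u : integral_unit u ->
  \prod_t normc (s t u) = 1.
Proof.
case=> u0 /integral_prod_normc[m mE] /integral_prod_normc[m' m'E].
have : \prod_t normc (s t u) * \prod_t normc (s t u^-1) = 1.
  rewrite -big_split big1 // => t _ /=.
  by rewrite -normcM -rmorphM divff // rmorph1 normc1.
rewrite mE m'E -rmorphM /= => /eqP; rewrite -[1]/(1%:~R) eqr_int => /eqP mm'.
suffices -> : `|m| = 1 by [].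
move: mm'; rewrite -!abszE -PoszM => -[/eqP]; rewrite muln_eq1 => /andP[/eqP -> _].
by [].
Qed.

(** Points in the same cell of the grid of mesh 1/2 differ by less than
    sqrt (1/2). *)
Lemma half_box_close (x y : R[i]) :
  Num.floor (2 * complex.Re x) = Num.floor (2 * complex.Re y) ->
  Num.floor (2 * complex.Im x) = Num.floor (2 * complex.Im y) ->
  normc (x - y) < 1.
Proof.
have close (a b : R) : Num.floor (2 * a) = Num.floor (2 * b) -> (a - b) ^+ 2 < 1 / 4.
  move=> ab; have := floor_itv (2 * a); have := floor_itv (2 * b); rewrite -ab.
  rewrite intrD mulr1z => /andP[b1 b2] /andP[a1 a2].
  have : 0 < (1 / 2 - (a - b)) * (1 / 2 + (a - b)) by apply: mulr_gt0; lra.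
  by rewrite -subr_sqr subr_gt0 expr_div_n expr1n -natrX.
case: x y => a b [c d] /= /close h1 /close h2.
rewrite -sqrtr1 ltr_sqrt //; lra.
Qed.

(** Kronecker's theorem. By pigeonhole two powers x^m and x^n have, under every
    embedding, values in the same cell of a grid of mesh 1/2. The norm of their
    difference is an integer of absolute value less than 1, hence 0. *)
Lemma integral_normc1_root_of_unity (x : F) : x != 0 -> algebraic_integer x ->
  (forall t, normc (s t x) = 1) -> Defs.root_of_unity x.
Proof.
move=> x0 x_int s_x1.
(* Five cells cover [-1, 1]: floor (2 a) ranges from -2 to 2. *)
pose cell (a : R) : 'I_5 := inord (absz (Num.floor (2 * a) + 2)).
have cell_inj (a b : R) : -1 <= a <= 1 -> -1 <= b <= 1 -> cell a = cell b ->
    Num.floor (2 * a) = Num.floor (2 * b).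
  have cell_bd (c : R) : -1 <= c <= 1 -> -2 <= Num.floor (2 * c) <= 2.
    move=> /andP[c1 c2]; have /andP[f1 f2] := floor_itv (2 * c).
    have f_lb : (- 2)%:~R < (Num.floor (2 * c) + 1)%:~R :> R.
      by apply: le_lt_trans f2; rewrite intrN; lra.
    have f_ub : (Num.floor (2 * c))%:~R <= 2%:~R :> R by apply: le_trans f1 _; lra.
    by move: f_lb f_ub; rewrite ltr_int ler_int; lia.
  move=> /cell_bd ha /cell_bd hb /(congr1 val); rewrite /= !inordK; lia.
pose N := #|{ffun T -> 'I_5 * 'I_5}|.
pose box (n : 'I_N.+1) : {ffun T -> 'I_5 * 'I_5} :=
  [ffun t => (cell (complex.Re (s t (x ^+ n))), cell (complex.Im (s t (x ^+ n))))].
have : ~~ injectiveb box.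
  apply/negP => /injectiveP/leq_card; rewrite card_ord ltnn //.
move=> /injectivePn[n [m nm box_eq]].
wlog mn : n m nm box_eq / (m < n)%N.
  move=> IH; case: (ltngtP m n) => [mn|mn|/val_inj mn]; first exact: (IH n m).
    by apply: (IH m n) => //; rewrite eq_sym.
  by rewrite mn eqxx in nm.
have s_pow k t : normc (s t (x ^+ k)) = 1.
  rewrite rmorphXn /=; elim: k => [|k IHk]; first exact: normc1.
  by rewrite exprS normcM IHk s_x1 mulr1.
have coord_bd (y : R[i]) : normc y = 1 ->
    -1 <= complex.Re y <= 1 /\ -1 <= complex.Im y <= 1.
  case: y => a b /= /(congr1 (fun c => c ^+ 2)); rewrite sqr_sqrtr ?expr1n.
    by move=> ab; split; nra.
  by rewrite addr_ge0 ?sqr_ge0.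
have close t : normc (s t (x ^+ n - x ^+ m)) < 1.
  rewrite rmorphB; move/ffunP/(_ t): box_eq; rewrite !ffunE => -[re_eq im_eq].
  have [ren imn] := coord_bd _ (s_pow n t); have [rem imm] := coord_bd _ (s_pow m t).
  by apply: half_box_close; apply: cell_inj.
have [k kE] : exists k : int, \prod_t normc (s t (x ^+ n - x ^+ m)) = `|k|%:~R.
  by apply: integral_prod_normc; apply: integral_sub; apply: algebraic_integerX.
have [t0 _] : exists t0 : T, t0 \in T.
  by apply/card_gt0P; rewrite cardT adim_gt0.
have : \prod_t normc (s t (x ^+ n - x ^+ m)) < 1.
  rewrite (bigD1 t0) //=; apply: le_lt_trans (close t0).
  apply: ler_piMr; first exact: normc_ge0.
  suffices /andP[] : 0 <= \prod_(t | t != t0) normc (s t (x ^+ n - x ^+ m)) <= 1 by [].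
  elim/big_rec: _ => [|t y _ /andP[y0 y1]]; first by rewrite ler01 lexx.
  by rewrite mulr_ge0 ?normc_ge0 // mulr_ile1 ?normc_ge0 // ltW.
rewrite kE -[1]/(1%:~R) ltr_int => k_lt1.
have k0 : k = 0 by lia.
move/eqP: kE; rewrite k0 normr0 => /prodf_eq0[t _ /eqP/eq0_normc/eqP].
rewrite fmorph_eq0 subr_eq0 => /eqP x_nm.
exists (n - m)%N; first by rewrite subn_gt0.
by apply: (mulfI (expf_neq0 m x0)); rewrite -exprD subnKC ?(ltnW mn) // mulr1.
Qed.

End AbsoluteValues.

(** * The logarithmic embedding *)

Section LogEmbedding.

Variables (R : realType) (K : fieldExtType rat) (r : nat).
Variables (iota : {rmorphism K -> R}) (tau : 'I_r -> {rmorphism K -> R[i]}).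

Local Notation Log := (Log iota tau).

Lemma LogE (x : K) (v : 'rV[R]_r.+1) : v 0 ord0 = ln `|iota x| ->
  (forall k, v 0 (lift ord0 k) = 2 * ln (normc (tau k x))) -> Log x = v.
Proof.
move=> v0 vk; apply/rowP => j; rewrite mxE.
by case: (unliftP ord0 j) => [k ->|->]; rewrite ?v0 ?vk.
Qed.

Lemma Log_ord0 x : Log x 0 ord0 = ln `|iota x|.
Proof. by rewrite mxE unlift_none. Qed.

Lemma Log_lift x k : Log x 0 (lift ord0 k) = 2 * ln (normc (tau k x)).
Proof. by rewrite mxE liftK. Qed.

Lemma Log1 : Log 1 = 0.
Proof.
by apply: LogE => [|k]; rewrite mxE rmorph1 ?normr1 ?normc1 ln1 // mulr0.
Qed.

(** The nonvanishing hypotheses matter because [ln] is 0 at 0, so [Log] is a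
    morphism on nonzero elements only. *)
Lemma LogM x y : x != 0 -> y != 0 -> Log (x * y) = Log x + Log y.
Proof.
move=> x0 y0; apply: LogE => [|k].
  by rewrite mxE !Log_ord0 rmorphM normrM lnM // posrE normr_gt0 fmorph_eq0.
rewrite mxE !Log_lift rmorphM normcM lnM ?mulrDr //.
  by rewrite posrE normc_gt0 ?fmorph_eq0.
by rewrite posrE normc_gt0 ?fmorph_eq0.
Qed.

Lemma LogV x : x != 0 -> Log x^-1 = - Log x.
Proof.
move=> x0; apply/eqP; rewrite -addr_eq0 -LogM ?invr_eq0 //.
by rewrite mulVf // Log1.
Qed.

Lemma LogX x n : x != 0 -> Log (x ^+ n) = Log x *+ n.
Proof.
move=> x0; elim: n => [|n IHn]; first exact: Log1.
by rewrite exprS mulrS LogM ?expf_neq0 // IHn.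
Qed.

Lemma LogXz x (m : int) : x != 0 -> Log (x ^ m) = Log x *~ m.
Proof.
move=> x0; case: m => n; first exact: LogX.
by rewrite NegzE mulrNz -exprnN LogV ?expf_neq0 // LogX.
Qed.

Lemma Log_prod n (u : 'I_n -> K) (c : 'I_n -> int) : (forall i, u i != 0) ->
  Log (\prod_i u i ^ c i) = \sum_i Log (u i) *~ c i.
Proof.
move=> u0.
have [] : \prod_i u i ^ c i != 0 /\ Log (\prod_i u i ^ c i) = \sum_i Log (u i) *~ c i.
  elim/big_ind2: _ => [|x x' y y' [x0 xE] [y0 yE]|i _].
  - by split; [exact: oner_neq0 | exact: Log1].
  - by split; [exact: mulf_neq0 | rewrite LogM // xE yE].
  - by split; [exact: expfz_neq0 | exact: (LogXz _ (u0 i))].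
by [].
Qed.

Lemma root_of_unity_Log w : Defs.root_of_unity w -> Log w = 0.
Proof.
move=> [n n_gt0 wn]; have w0 : w != 0.
  by apply: contra_eq_neq wn => ->; rewrite expr0n gtn_eqF // eq_sym oner_neq0.
have := LogX n w0; rewrite wn Log1 => /esym/eqP; rewrite -scaler_nat.
by rewrite scaler_eq0 pnatr_eq0 gtn_eqF //= => /eqP.
Qed.

Hypothesis dimK : \dim {:K} = r.*2.+1.
Hypothesis K_emb : one_real_embedding iota tau.

(** The real embedding, the given representatives and their conjugates. Being
    2r + 1 = [\dim K] in number and pairwise distinct, they are all of them. *)
Definition complex_embedding (t : option ('I_r * bool)) : {rmorphism K -> R[i]} :=
  match t with
  | None => real_complex R \o iota
  | Some (i, false) => tau i
  | Some (i, true) => conjc \o tau i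
  end.

Lemma card_complex_embedding : #|{: option ('I_r * bool)}| = \dim {:K}.
Proof. by rewrite card_option card_prod card_ord card_bool muln2 dimK. Qed.

Lemma complex_embedding_inj t t' :
  complex_embedding t =1 complex_embedding t' -> t = t'.
Proof.
have [_ tau_not_real tau_inj _] := K_emb.
have not_iota i b : ~ complex_embedding (Some (i, b)) =1 complex_embedding None.
  move=> iE; apply: (tau_not_real i) => x; have := iE x.
  case: b {iE} => /=; last by move=> ->; rewrite conjc_real.
  by move/(congr1 conjc); rewrite conjcK conjc_real => ->; rewrite conjc_real.
case: t t' => [[i b]|] [[j b']|] // ttE; last 2 first.
- by case: (not_iota i b).
- by case: (not_iota j b') => x; rewrite ttE.
case: b b' ttE => -[] /= ijE.
- by rewrite (tau_inj i j) //; left=> x; apply: (can_inj (@conjcK R)); apply: ijE.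
- have ij : i = j by apply: tau_inj; right=> x; rewrite -ijE /= conjcK.
  by case: (tau_not_real j) => x; rewrite -[in LHS]ijE /= ij.
- have ij : i = j by apply: tau_inj; right=> x; apply: ijE.
  by case: (tau_not_real j) => x; rewrite -[in LHS]ij; apply: ijE.
- by rewrite (tau_inj i j) //; left.
Qed.

Lemma normc_conj (x : R[i]) : normc (conjc x) = normc x.
Proof. by case: x => a b /=; rewrite sqrrN. Qed.

(** The factor 2 in [Log] accounts for the conjugate of each [tau i]. *)
Lemma sum_Log x : x != 0 ->
  \sum_j Log x 0 j = ln (\prod_t normc (complex_embedding t x)).
Proof.
move=> x0.
have pos t : normc (complex_embedding t x) \is Num.pos.
  by rewrite posrE normc_gt0 ?fmorph_eq0.
have ln_prod : ln (\prod_t normc (complex_embedding t x))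
    = \sum_t ln (normc (complex_embedding t x)).
  have [] : \prod_t normc (complex_embedding t x) \is Num.pos /\
      ln (\prod_t normc (complex_embedding t x))
        = \sum_t ln (normc (complex_embedding t x)).
    elim/big_ind2: _ => [|a a' b b' [a0 aE] [b0 bE]|t _].
    - by split; [rewrite posrE ltr01 | exact: ln1].
    - by split; [rewrite posrE mulr_gt0 | rewrite lnM // aE bE].
    - by split; [exact: pos |].
  by [].
rewrite ln_prod (bigD1 None) // big_ord_recl Log_ord0 -normc_real; congr (_ + _).
rewrite (reindex_omap Some id) /=; last by case.
rewrite [RHS](eq_bigl xpredT) => [|t]; last by rewrite eqxx.
rewrite -[RHS](eq_bigr _ (fun t _ => congr1 (fun t => ln (normc (complex_embedding (Some t) x)))
   (esym (surjective_pairing t)))).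
rewrite -(pair_bigA _ (fun i b => ln (normc (complex_embedding (Some (i, b)) x)))).
apply: eq_bigr => i _.
by rewrite big_bool /= normc_conj Log_lift -mulr2n mulr_natl.
Qed.

Lemma integral_unit_sum_Log x : integral_unit x -> \sum_j Log x 0 j = 0.
Proof.
move=> x_unit; have [x0 _ _] := x_unit; rewrite sum_Log //.
rewrite (integral_unit_product_formula complex_embedding_inj) ?ln1 //.
exact: card_complex_embedding.
Qed.

Lemma Log_eq0_root_of_unity x : integral_unit x -> Log x = 0 -> Defs.root_of_unity x.
Proof.
move=> [x0 x_int _] /rowP Logx0.
have ln_eq0_1 (a : R) : 0 < a -> ln a = 0 -> a = 1.
  by move=> a0 /eqP; rewrite ln_eq0 // => /eqP.
apply: (integral_normc1_root_of_unity complex_embedding_inj card_complex_embedding) => //.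
have tau1 i : normc (tau i x) = 1.
  apply: ln_eq0_1; first by rewrite normc_gt0 ?fmorph_eq0.
  have := Logx0 (lift ord0 i); rewrite Log_lift mxE => /eqP.
  by rewrite mulf_eq0 pnatr_eq0 /= => /eqP.
case=> [[i []]|]; [exact: etrans (normc_conj _) (tau1 i) | exact: tau1 |].
apply: etrans (normc_real _) _; apply: ln_eq0_1; first by rewrite normr_gt0 fmorph_eq0.
by have := Logx0 ord0; rewrite Log_ord0 mxE.
Qed.

Lemma unit_basis_Z_basis n (u : 'I_n -> K) :
  unit_basis u -> Z_basis (log_units iota tau) (fun i => Log (u i)).
Proof.
move=> [u_unit u_gen u_free]; have u0 i : u i != 0 by case: (u_unit i).
split=> [v|c].
  split=> [[x x_unit ->] | [c ->]].
    have [c [w [w_root xE]]] := u_gen x x_unit; exists c.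
    have [x0 _ _] := x_unit.
    move: x0; rewrite xE mulf_eq0 negb_or => /andP[w0 p0].
    by rewrite LogM // root_of_unity_Log // add0r Log_prod.
  exists (\prod_i u i ^ c i); first exact: integral_unit_prod.
  by rewrite Log_prod.
rewrite -Log_prod // => Log0; apply: u_free; apply: Log_eq0_root_of_unity Log0.
exact: integral_unit_prod.
Qed.

Lemma Z_basis_unit_basis n (u : 'I_n -> K) : (forall i, integral_unit (u i)) ->
  Z_basis (log_units iota tau) (fun i => Log (u i)) -> unit_basis u.
Proof.
move=> u_unit [Log_gen Log_free]; have u0 i : u i != 0 by case: (u_unit i).
split=> // [x x_unit | c c_root]; last first.
  by apply: Log_free; rewrite -Log_prod // root_of_unity_Log.
have [c LogxE] := (Log_gen (Log x)).1 (ex_intro2 _ _ x x_unit erefl).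
have y_unit := integral_unit_prod c u_unit.
set y := \prod_i u i ^ c i in y_unit; have [[x0 _ _] [y0 _ _]] := (x_unit, y_unit).
exists c, (x / y); split; last by rewrite divfK.
apply: Log_eq0_root_of_unity; first exact/integral_unitM/integral_unitV.
by rewrite LogM ?invr_eq0 // LogV // LogxE /y Log_prod // subrr.
Qed.

End LogEmbedding.

(** * Matrices whose rows sum to zero *)

Section ZeroSum.

Variables (R : fieldType) (r : nat).

Lemma zero_sum_col'_eq0 (y : 'rV[R]_r.+1) :
  \sum_l y 0 l = 0 -> col' ord_max y = 0 -> y = 0.
Proof.
move=> y_sum /rowP y0.
have y_lift l : y 0 (lift ord_max l) = 0 by have := y0 l; rewrite !mxE.
apply/rowP => l; rewrite mxE; case: (unliftP ord_max l) => [m ->|->] //.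
by move: y_sum; rewrite (bigD1_ord ord_max) //= big1 ?addr0.
Qed.

(** Put the row e_k - e_k' on top of [A]. The square matrix so obtained kills the
    all-ones vector, so its determinant vanishes; expand it along that row. *)
Lemma cofactor_zero_sum (A : 'M[R]_(r, r.+1)) (k k' : 'I_r.+1) :
  (forall i, \sum_l A i l = 0) ->
  (-1) ^+ k * \det (col' k A) = (-1) ^+ k' * \det (col' k' A).
Proof.
move=> A0.
pose v : 'rV[R]_r.+1 := delta_mx 0 k - delta_mx 0 k'.
pose B : 'M[R]_r.+1 := col_mx v A.
have rowB : row' ord0 B = A.
  apply/matrixP => i l; rewrite mxE.
  have -> : lift ord0 i = rshift 1 i by apply: val_inj.
  by rewrite [B _ _]col_mxEd.
have cofB l : cofactor B ord0 l = (-1) ^+ l * \det (col' l A).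
  by rewrite /cofactor add0n; congr (_ * \det _); rewrite -rowB; apply/matrixP => i m; rewrite !mxE.
have B0 l : B ord0 l = (l == k)%:R - (l == k')%:R.
  have -> : ord0 = lshift r (ord0 : 'I_1) by apply: val_inj.
  by rewrite [B _ _]col_mxEu !mxE.
have sum_delta (f : 'I_r.+1 -> R) : \sum_l B ord0 l * f l = f k - f k'.
  under eq_bigr => l _ do rewrite B0 mulrBl.
  rewrite sumrB (bigD1 k) //= [X in _ - X](bigD1 k') //= !eqxx !mul1r.
  by rewrite !big1 ?addr0 // => l /negPf ->; rewrite mul0r.
have detB : \det B = 0.
  rewrite -det_tr; apply/eqP/det0P; exists (const_mx 1).
    by apply/eqP => /rowP/(_ ord0); rewrite !mxE => /eqP; rewrite oner_eq0.
  apply/rowP => i; rewrite !mxE; case: (unliftP ord0 i) => [i' ->|->].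
    rewrite -[RHS](A0 i') -rowB; apply: eq_bigr => l _.
    by rewrite [in RHS]mxE [const_mx _ _ _]mxE [B^T _ _]mxE mul1r.
  rewrite -[RHS](subrr 1) -(sum_delta (fun=> 1)); apply: eq_bigr => l _.
  by rewrite [const_mx _ _ _]mxE [B^T _ _]mxE mulrC.
move: detB; rewrite (expand_det_row _ ord0) sum_delta => /eqP.
by rewrite subr_eq0 !cofB => /eqP.
Qed.

End ZeroSum.

Lemma norm_minor_zero_sum (R : numFieldType) r (A : 'M[R]_(r, r.+1)) (k k' : 'I_r.+1) :
  (forall i, \sum_l A i l = 0) -> `|\det (col' k A)| = `|\det (col' k' A)|.
Proof.
move=> /(cofactor_zero_sum k k')/(congr1 Num.norm).
by rewrite !normrM !normrX !normrN1 !expr1n !mul1r.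
Qed.

(** * Extension of scalars and transport of lattices *)

Section ScalarExtensionSpan.

Variables (R : realType) (F : fieldExtType rat) (V : lmodType R) (j : F -> V).

Lemma Q_linear_lincomb n (c : 'I_n -> rat) (b : 'I_n -> F) : Q_linear j ->
  j (\sum_k c k *: b k) = \sum_k ratr (c k) *: j (b k).
Proof.
move=> j_lin; have j0 : j 0 = 0.
  by have := j_lin (-1) 0 0; rewrite scaler0 addr0 rmorphN1 scaleN1r addNr.
by elim/big_rec2: _ => // k x y _ <-; apply: j_lin.
Qed.

(** With [g] extending the coordinate map to R^n and [h] sending coordinates back
    to combinations of the j (b k), the maps h \o g and id both extend [j], so
    they coincide by the uniqueness half of the universal property. *)
Lemma scalar_extension_spanning n (b : 'I_n -> F) :
    scalar_extension j -> Q_spanning b -> Q_free b ->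
  forall v, exists c : 'I_n -> R, v = \sum_k c k *: j (b k).
Proof.
move=> [j_lin j_univ] /choice[c cE] b_free v.
pose f x : 'rV[R]_n := \row_k ratr (c x k).
have f_lin : Q_linear f.
  move=> a x y; apply/rowP => k; rewrite !mxE -rmorphM -rmorphD; congr (ratr _).
  apply/eqP; rewrite -subr_eq0; apply/eqP.
  apply: (b_free (fun k => c (a *: x + y) k - (a * c x k + c y k))).
  under eq_bigr => l _ do rewrite scalerBl scalerDl -scalerA.
  by rewrite sumrB big_split -scaler_sumr -!cE subrr.
have [g [g_f _]] := j_univ _ f f_lin.
pose h (w : 'rV[R]_n) : V := \sum_k w 0 k *: j (b k).
have h_lin : linear h.
  move=> a w w'; rewrite /h scaler_sumr -big_split; apply: eq_bigr => k _.
  by rewrite !mxE scalerDl scalerA.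
pose h_sl := GRing.isSemilinear.Build R _ _ _ h (GRing.semilinear_linear h_lin).
pose hL : {linear 'rV[R]_n -> V} := HB.pack h h_sl.
have [g0 [_ g0_uniq]] := j_univ V j j_lin.
have hgE : h (g v) = v.
  transitivity (g0 v); first apply: (g0_uniq (hL \o g)).
    move=> x /=; rewrite [g _]g_f [RHS](congr1 j (cE x)) Q_linear_lincomb //.
    by apply: eq_bigr => k _; rewrite mxE.
  by apply/esym; apply: (g0_uniq idfun).
by exists (fun k => g v 0 k); rewrite -[LHS]hgE.
Qed.

End ScalarExtensionSpan.

Lemma Z_basis_preimage (V W : zmodType) (phi : {additive V -> W}) (S : set W) n (b : 'I_n -> V) :
  injective phi -> (forall y, S y -> exists v, y = phi v) ->
  Z_basis (phi @^-1` S)%classic b <-> Z_basis S (phi \o b).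
Proof.
move=> phi_inj phi_surj.
have phi_sum (c : 'I_n -> int) : phi (\sum_i b i *~ c i) = \sum_i (phi \o b) i *~ c i.
  by rewrite raddf_sum; apply: eq_bigr => i _; rewrite raddfMz.
split=> -[b_gen b_free]; split=> [y|c].
- split=> [Sy | [c ->]].
    have [v yE] := phi_surj y Sy; move: Sy; rewrite yE => /(b_gen v).1[c ->].
    by exists c.
  by rewrite -phi_sum; apply/(b_gen _).2; exists c.
- by move=> c0; apply: b_free; apply: phi_inj; rewrite phi_sum c0 raddf0.
- split=> [/(b_gen _).1[c]|[c ->]]; first by rewrite -phi_sum => /phi_inj ->; exists c.
  by rewrite /preimage /= phi_sum; apply/(b_gen _).2; exists c.
- by move=> c0; apply: b_free; rewrite -phi_sum c0 raddf0.
Qed.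

(** * The regulator formula *)

Section RegulatorFormula.

Variables (R : realType) (r : nat) (K : fieldExtType rat).
Variables (iota : {rmorphism K -> R}) (tau : 'I_r -> {rmorphism K -> R[i]}).
Variables (L : fieldExtType rat) (z : L) (V : lmodType R) (j : Qplus z -> V).
Variable phi : {linear V -> 'rV[R]_r.+1}.

Hypotheses (r_gt1 : (1 < r)%N) (p_prime : prime r.*2.+1).
Hypothesis z_prim : (r.*2.+1).-primitive_root z.
Hypothesis dimK : \dim {:K} = r.*2.+1.
Hypothesis K_emb : one_real_embedding iota tau.
Hypothesis j_ext : scalar_extension j.
Hypothesis phiE : forall i : 'I_r,
  phi (j (Qplus_basis z i)) = row i (map_mx ratr (extended_gram z r)).

Local Notation Gt := (map_mx ratr (extended_gram z r) : 'M[R]_(r, r.+1)).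
Local Notation G := (map_mx ratr (Qplus_gram z r) : 'M[R]_r).
Local Notation b := (fun i : 'I_r => Qplus_basis z i).
Local Notation Log := (Log iota tau).
Local Notation units := (log_units iota tau).

Let Qp := Qplus_integral_structure p_prime z_prim r_gt1.

Lemma G_unit : G \in unitmx.
Proof.
by have [_ _ _ _ G_gt0] := Qp; rewrite unitmxE det_map_mx unitfE fmorph_eq0 gt_eqF.
Qed.

Lemma col'_Gt : col' ord_max Gt = G.
Proof. by apply/matrixP => i k; rewrite !mxE liftK !mxE. Qed.

Lemma col'_mul_Gt m (X : 'M[R]_(m, r)) : col' ord_max (X *m Gt) = X *m G.
Proof.
by rewrite -col'_Gt; apply/matrixP => i l; rewrite !mxE; apply: eq_bigr => k _; rewrite !mxE.
Qed.

Lemma Gt_zero_sum i : \sum_l Gt i l = 0.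
Proof.
rewrite (bigD1_ord ord_max) //= !mxE unlift_none rmorphN rmorph_sum addrC.
apply/eqP; rewrite subr_eq0; apply/eqP/eq_bigr => l _.
by rewrite !mxE liftK !mxE.
Qed.

Lemma mul_Gt_zero_sum m (X : 'M[R]_(m, r)) i : \sum_l (X *m Gt) i l = 0.
Proof.
under eq_bigr => l _ do rewrite mxE.
by rewrite exchange_big big1 // => k _; rewrite -mulr_sumr Gt_zero_sum mulr0.
Qed.

Lemma V_coord v : exists w : 'rV[R]_r, v = \sum_k w 0 k *: j (Qplus_basis z k).
Proof.
have [b_gen b_free _ _ _] := Qp.
have [c ->] := scalar_extension_spanning j_ext b_gen b_free v.
by exists (\row_k c k); apply: eq_bigr => k _; rewrite mxE.
Qed.

Lemma phi_coord (w : 'rV[R]_r) : phi (\sum_k w 0 k *: j (Qplus_basis z k)) = w *m Gt.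
Proof.
rewrite linear_sum mulmx_sum_row; apply: eq_bigr => k _.
by rewrite linearZ /= phiE.
Qed.

Lemma phi_inj : injective phi.
Proof.
move=> v v' /eqP; rewrite -subr_eq0 -linearB => /eqP; have [w vE] := V_coord (v - v').
rewrite vE phi_coord => wGt0; apply/eqP; rewrite -subr_eq0 vE; apply/eqP.
have w0 : w *m G = 0 by rewrite -col'_mul_Gt wGt0 raddf0.
have -> : w = 0 by rewrite -[w](mulmxK G_unit) w0 mul0mx.
by rewrite big1 // => k _; rewrite mxE scale0r.
Qed.

(** The image of [phi] is the whole zero-sum hyperplane since [G] is invertible,
    and the unit lattice lies in that hyperplane by the product formula. *)
Lemma units_phi y : units y -> exists v, y = phi v.
Proof.
move=> [x x_unit ->]; pose w := col' ord_max (Log x) *m invmx G.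
exists (\sum_k w 0 k *: j (Qplus_basis z k)); apply: etrans _ (esym (phi_coord w)).
apply/eqP; rewrite -subr_eq0; apply/eqP/zero_sum_col'_eq0.
  under eq_bigr => l _ do rewrite mxE [X in _ + X]mxE.
  by rewrite sumrB mul_Gt_zero_sum (integral_unit_sum_Log dimK K_emb) // subrr.
by rewrite raddfB /= col'_mul_Gt mulmxKV ?G_unit ?subrr.
Qed.

Let Z_basis_units (b' : 'I_r -> V) := Z_basis_preimage b' phi_inj units_phi.

(** With unimodular [U1] and [U2] relating the two bases of the unit lattice, and
    [a] to the chosen basis of A+, the matrix of the Log (u i) is
    U1 M U2 Gt. *)
Lemma norm_minor_Log u k (a : 'I_r -> Qplus z) (e : 'I_r -> V) (M : 'M[R]_r) :
    unit_basis u -> Z_basis (@Aplus L z) a -> Z_basis (phi @^-1` units)%classic e ->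
    (forall i, e i = \sum_k M i k *: j (a k)) ->
  `|\det (col' k (\matrix_(i < r) Log (u i)))| = `|\det M| * ratr (discriminant (Qplus z)).
Proof.
move=> u_basis a_basis /Z_basis_units e_basis eE.
have [_ _ b_basis discE G_gt0] := Qp.
have [U1 U1_unit LogE] := Z_basis_change e_basis (unit_basis_Z_basis dimK K_emb u_basis).
have [U2 U2_unit aE] := Z_basis_change b_basis a_basis.
have phi_a l : phi (j (a l)) = row l (map_mx intr U2 *m Gt).
  have -> : a l = \sum_m (U2 l m)%:~R *: Qplus_basis z m.
    by rewrite aE; apply: eq_bigr => m _; rewrite scaler_int.
  rewrite (Q_linear_lincomb _ _ j_ext.1) linear_sum row_mul mulmx_sum_row.
  by apply: eq_bigr => m _; rewrite linearZ /= phiE !mxE rmorph_int.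
have phi_e i : phi (e i) = row i (M *m (map_mx intr U2 *m Gt)).
  rewrite eE linear_sum row_mul mulmx_sum_row; apply: eq_bigr => l _.
  by rewrite linearZ /= phi_a !mxE.
have -> : \matrix_(i < r) Log (u i) = map_mx intr U1 *m M *m map_mx intr U2 *m Gt.
  apply/row_matrixP => i; rewrite rowK LogE -!mulmxA row_mul mulmx_sum_row.
  by apply: eq_bigr => l _; rewrite /= phi_e !mxE scaler_int.
rewrite (norm_minor_zero_sum k ord_max); last exact: mul_Gt_zero_sum.
rewrite col'_mul_Gt !det_mulmx !normrM !unitmx_int_norm_det // mul1r mulr1; congr (_ * _).
by rewrite det_map_mx discE ger0_norm // ler0q ltW.
Qed.

Lemma preimage_basis_of_unit_basis (u : 'I_r -> K) : unit_basis u ->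
  exists e : 'I_r -> V, Z_basis (phi @^-1` units)%classic e.
Proof.
move=> u_basis; have [u_unit _ _] := u_basis.
have /choice[e eE] i : exists v, Log (u i) = phi v.
  by apply: units_phi; exists (u i).
exists e; apply/Z_basis_units.
rewrite (_ : phi \o e = fun i => Log (u i)); last by apply/funext => i /=; rewrite eE.
exact: (unit_basis_Z_basis dimK K_emb u_basis).
Qed.

Lemma unit_basis_of_preimage_basis (e : 'I_r -> V) :
  Z_basis (phi @^-1` units)%classic e -> exists u : 'I_r -> K, unit_basis u.
Proof.
move=> e_basis; have /choice[u uE] i : exists x, integral_unit x /\ phi (e i) = Log x.
  by have [x x_unit xE] := Z_basis_mem i e_basis; exists x.
exists u; apply: (Z_basis_unit_basis dimK K_emb) => [i|]; first by case: (uE i).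
rewrite (_ : (fun i => Log (u i)) = phi \o e); first exact/Z_basis_units.
by apply/funext => i /=; case: (uE i).
Qed.

(** If there is no unit basis of size [r], there is no Z-basis of the preimage
    lattice either, and both sides are the default value 0. *)
Lemma regulator_formula : regulator iota tau =
    lattice_norm r j (Aplus (z := z)) (phi @^-1` units)%classic
      * ratr (discriminant (Qplus z)).
Proof.
have [_ _ b_basis _ _] := Qplus_integral_structure p_prime z_prim r_gt1.
have [[u u_basis]|no_u] := pselect (exists u : 'I_r -> K, unit_basis u); last first.
  rewrite /regulator /lattice_norm !xgetPN ?mul0r // => x.
    by move=> [a [e [M [_ e_basis _ _]]]]; apply/no_u/unit_basis_of_preimage_basis/e_basis.
  by move=> [u [k [u_basis _]]]; apply: no_u; exists u.
have [e e_basis] := preimage_basis_of_unit_basis u_basis.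
have /choice[M ME] i : exists w : 'rV[R]_r, e i = \sum_k w 0 k *: j (Qplus_basis z k).
  exact: V_coord.
rewrite /regulator /lattice_norm.
set S := [set x | _]%classic; set T := [set x | _]%classic.
have /(xgetI 0)[u' [k [u'_basis ->]]] : S `|\det (col' ord0 (\matrix_(i < r) Log (u i)))|.
  by exists u, ord0.
have /(xgetI 0)[a [e' [M' [a_basis e'_basis e'E ->]]]] : T `|\det (\matrix_(i, k) M i 0 k)|.
  exists (fun i => Qplus_basis z i), e, (\matrix_(i, k) M i 0 k); split=> // i.
  by rewrite ME; apply: eq_bigr => l _; rewrite mxE.
exact: norm_minor_Log u'_basis a_basis e'_basis e'E.
Qed.

End RegulatorFormula.

Theorem proposition1p4 (R : realType) (p r : nat)
    (hp : prime p) (hp5 : (5 <= p)%N) (hr : r = p.-1./2)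
    (K : fieldExtType rat) (hK : dihedral_extension p K)
    (iota : {rmorphism K -> R}) (tau : 'I_r -> {rmorphism K -> R[i]})
    (hemb : one_real_embedding iota tau)
    (L : fieldExtType rat) (z : L) (hz : p.-primitive_root z)
    (V : lmodType R) (j : Qplus z -> V) (hj : scalar_extension j)
    (phi : {linear V -> 'rV[R]_r.+1})
    (hphi : forall i : 'I_r,
      phi (j (Qplus_basis z i)) = row i (map_mx ratr (extended_gram z r))) :
  regulator iota tau =
    lattice_norm r j (Aplus (z := z)) (phi @^-1` log_units iota tau)%classic
      * ratr (discriminant (Qplus z)).
Proof.
have pE : p = r.*2.+1.
  have p_odd : odd p by case: (even_prime hp) hp5 => // ->.
  by rewrite hr; move: p_odd hp5; case: (p) => // n; rewrite /= => n_even _; rewrite even_halfK.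
have r_gt1 : (1 < r)%N by move: hp5; rewrite pE; lia.
have [dimK _] := hK; rewrite pE in hp hz dimK.
exact: regulator_formula.
Qed.
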